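(* For every $\varepsilon>0$ there is $n_0$ such that for all $n\ge n_0$: (1) $\mathrm{FIX}(W_n)\le(2+\varepsilon)\sqrt n$; (2) $\mathrm{FIX}(F_n)\le(2\sqrt2+\varepsilon)\sqrt n$. (That is, $\mathrm{FIX}(W_n)\le(2+o(1))\sqrt n$ and $\mathrm{FIX}(F_n)\le(2\sqrt2+o(1))\sqrt n$.)
   Context: $W_n=C_{n-1}*E_1$ is the wheel on $n$ vertices (a cycle on $n-1$ vertices joined to one extra vertex adjacent to all of them) and $F_n=P_{n-1}*E_1$ is the fan on $n$ vertices (a path on $n-1$ vertices joined to one extra vertex). For a planar graph $G$, a drawing is an injective map $\pi\colon V(G)\to\mathbb{R}^2$ with edges drawn as straight segments; a plane straight line drawing is one in which edge segments meet only at common endpoints and contain no other vertex images. $\mathrm{fix}(G,\pi)$ is the maximum over plane straight line drawings $\pi'$ of $|\{v:\pi'(v)=\pi(v)\}|$; for $X\subset\mathbb{R}^2$ with $|X|=|V(G)|$, $\mathrm{fix}_X(G)=\min\{\mathrm{fix}(G,\pi):\pi(V(G))=X\}$; and $\mathrm{FIX}(G)=\max_X\mathrm{fix}_X(G)$ over all $|V(G)|$-point sets $X$ in the plane. *)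

(* Defs.v *)
From HB Require Import structures.
From mathcomp Require Import all_boot all_order all_algebra.
From mathcomp Require Import boolp classical_sets functions cardinality reals.

Set Implicit Arguments.
Unset Strict Implicit.
Unset Printing Implicit Defensive.

Import Order.TTheory GRing.Theory Num.Theory.

Local Open Scope classical_set_scope.
Local Open Scope card_scope.

Record sgraph := SGraph {
  vertex :> finType;
  adj : rel vertex;
  adj_sym : symmetric adj;
  adj_irr : irreflexive adj }.

Definition path_adj (m : nat) : rel 'I_m :=
  fun i j => (j == i.+1 :> nat) || (i == j.+1 :> nat).

Lemma path_adj_sym m : symmetric (@path_adj m).
Proof. by move=> i j; rewrite /path_adj orbC. Qed.

Lemma path_adj_irr m : irreflexive (@path_adj m).
Proof. by move=> i; rewrite /path_adj orbb; apply/eqP/n_Sn. Qed.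

Definition path_graph m := SGraph (@path_adj_sym m) (@path_adj_irr m).

(* [i != j] only matters for [m = 1], where it removes the loop. *)
Definition cycle_adj (m : nat) : rel 'I_m :=
  fun i j =>
  (i != j) && ((j == i.+1 %% m :> nat) || (i == j.+1 %% m :> nat)).

Lemma cycle_adj_sym m : symmetric (@cycle_adj m).
Proof. by move=> i j; rewrite /cycle_adj eq_sym orbC. Qed.

Lemma cycle_adj_irr m : irreflexive (@cycle_adj m).
Proof. by move=> i; rewrite /cycle_adj eqxx. Qed.

Definition cycle_graph m := SGraph (@cycle_adj_sym m) (@cycle_adj_irr m).

Definition empty_adj (m : nat) : rel 'I_m := fun _ _ => false.

Lemma empty_adj_sym m : symmetric (@empty_adj m).
Proof. by []. Qed.

Lemma empty_adj_irr m : irreflexive (@empty_adj m).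
Proof. by []. Qed.

Definition empty_graph m := SGraph (@empty_adj_sym m) (@empty_adj_irr m).

Definition join_adj (G H : sgraph) : rel (G + H)%type := fun x y =>
  match x, y with
  | inl u, inl v => adj u v
  | inr u, inr v => adj u v
  | _, _ => true
  end.

Lemma join_adj_sym G H : symmetric (@join_adj G H).
Proof. by move=> [x|x] [y|y] //=; exact: adj_sym. Qed.

Lemma join_adj_irr G H : irreflexive (@join_adj G H).
Proof. by move=> [x|x] /=; exact: adj_irr. Qed.

Definition join_graph G H := SGraph (@join_adj_sym G H) (@join_adj_irr G H).

Definition wheel n := join_graph (cycle_graph n.-1) (empty_graph 1).
Definition fan n := join_graph (path_graph n.-1) (empty_graph 1).

Section Drawings.
Variable R : realType.
Local Open Scope ring_scope.

Definition segment (a b : R * R) : set (R * R) :=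
  [set p | exists t : R, 0 <= t <= 1 /\
     p = ((1 - t) * a.1 + t * b.1, (1 - t) * a.2 + t * b.2)].

Variable G : sgraph.

(* For an injective [pi], a point that is an endpoint of both segments is the
   image of a common endpoint of the two edges. *)
Definition plane_drawing (pi : G -> R * R) : Prop :=
  [/\ injective pi,
      forall u v x y : G, adj u v -> adj x y ->
        [set u; v] <> [set x; y] ->
        segment (pi u) (pi v) `&` segment (pi x) (pi y) `<=`
          [set pi u; pi v] `&` [set pi x; pi y]
    & forall u v w : G, adj u v -> w != u -> w != v ->
        ~ segment (pi u) (pi v) (pi w)].

Local Open Scope nat_scope.

Definition nb_fixed (pi pi' : G -> R * R) : nat := #|[pred v | pi' v == pi v]|.

(* In the next three definitions the set of values over which the extremum is
   taken is contained in {0, ..., #|G|}. The maximum over an empty set is 0,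
   the minimum over an empty set is #|G|. *)
Definition fix_drawing (pi : G -> R * R) : nat :=
  \max_(k < #|G|.+1 |
        `[< exists2 pi', plane_drawing pi' & nb_fixed pi pi' = k >]) k.

Definition fix_set (X : set (R * R)) : nat :=
  \big[minn/#|G|]_(k < #|G|.+1 |
        `[< exists2 pi : G -> R * R,
              injective pi /\ range pi = X & fix_drawing pi = k >]) k.

Definition FIX : nat :=
  \max_(k < #|G|.+1 |
        `[< exists2 X : set (R * R), X #= `I_#|G| & fix_set X = k >]) k.

End Drawings.

Section Extrema.
Variables (R : realType) (G : sgraph).
Implicit Types (pi : G -> R * R) (X : set (R * R)).

Lemma fix_drawing_ub pi pi' :
  plane_drawing pi' -> nb_fixed pi pi' <= fix_drawing pi.
Proof.
move=> pd; have lt : nb_fixed pi pi' < #|G|.+1 by rewrite ltnS max_card.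
apply: (@leq_bigmax_cond _ _ (fun k : 'I_#|G|.+1 => k : nat) (Ordinal lt)).
by apply/asboolP; exists pi'.
Qed.

Lemma fix_drawing_attained pi : (exists pi' : G -> R * R, plane_drawing pi') ->
  exists2 pi' : G -> R * R, plane_drawing pi' & nb_fixed pi pi' = fix_drawing pi.
Proof.
move=> [p0 pd]; have lt : nb_fixed pi p0 < #|G|.+1 by rewrite ltnS max_card.
rewrite /fix_drawing (bigop.bigmax_eq_arg (Ordinal lt)); last first.
  by apply/asboolP; exists p0.
by case: arg_maxnP => [|i /asboolP //]; apply/asboolP; exists p0.
Qed.

Lemma fix_drawing_le pi : fix_drawing pi <= #|G|.
Proof. by apply/bigmax_leqP => k _; rewrite -ltnS. Qed.

Let bigminn_le m n (P : pred 'I_n) (i : 'I_n) :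
  P i -> \big[minn/m]_(k < n | P k) k <= i.
Proof.
move=> Pi; have := mem_index_enum i; elim: (index_enum _) => // j s IHs.
rewrite inE big_cons => /predU1P[<-|/IHs le]; first by rewrite Pi geq_minl.
by case: ifP => // _; rewrite geq_min le orbT.
Qed.

Lemma fix_set_lb pi : injective pi -> fix_set G (range pi) <= fix_drawing pi.
Proof.
move=> inj; have lt : fix_drawing pi < #|G|.+1 by rewrite ltnS fix_drawing_le.
by apply: (@bigminn_le _ _ _ (Ordinal lt)); apply/asboolP; exists pi.
Qed.

Lemma fix_set_attained X : X #= `I_#|G| ->
  exists2 pi : G -> R * R, injective pi /\ range pi = X &
    fix_drawing pi = fix_set G X.
Proof.
move=> cX.
have [pi0 [inj0 rX]] : exists pi : G -> R * R, injective pi /\ range pi = X.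
  pose U : pointedType := HB.pack (R * R)%type (isPointed.Build _ (0, 0)%R).
  have /(@card_set_bijP nat U)[f [fX finj fsurj]] : `I_#|G| #= X by rewrite card_eq_sym.
  exists (fun v => f (enum_rank v)); split.
    move=> u v /finj; rewrite !inE /= => /(_ (ltn_ord _) (ltn_ord _)) e.
    exact/enum_rank_inj/val_inj.
  apply/seteqP; split => [_ [v _ <-]|x /fsurj[k /= kG <-]].
    by apply: fX => /=.
  by exists (enum_val (Ordinal kG)) => //; rewrite enum_valK.
pose P k := exists2 pi : G -> R * R, injective pi /\ range pi = X &
  fix_drawing pi = k.
suff : P (fix_set G X) by [].
have [e|//] : fix_set G X = #|G| \/ P (fix_set G X).
  apply: (big_ind (fun m => m = #|G| \/ P m)) => [|x y|k /asboolP ?].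
  - by left.
  - by rewrite /minn; case: ifP.
  - by right.
suff <- : fix_drawing pi0 = fix_set G X by exists pi0.
apply/eqP; rewrite eqn_leq {1}e fix_drawing_le -rX /=; exact: fix_set_lb.
Qed.

Lemma fix_set_le X : fix_set G X <= #|G|.
Proof.
apply: (big_ind (fun m => m <= #|G|)) => // [x y xG _|k _].
  by rewrite geq_min xG.
by rewrite -ltnS.
Qed.

Lemma FIX_ub X : X #= `I_#|G| -> fix_set G X <= FIX R G.
Proof.
move=> cX; have lt : fix_set G X < #|G|.+1 by rewrite ltnS fix_set_le.
apply: (@leq_bigmax_cond _ _ (fun k : 'I_#|G|.+1 => k : nat) (Ordinal lt)).
by apply/asboolP; exists X.
Qed.

Lemma FIX_attained : exists2 X : set (R * R), X #= `I_#|G| & fix_set G X = FIX R G.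
Proof.
have [X cX] : exists X : set (R * R), X #= `I_#|G|.
  exists ((fun k : nat => (k%:R, 0)%R) @` `I_#|G|).
  apply: card_eq_trans (card_eqxx _); apply: inj_card_eq => i j _ _ [] /eqP.
  by rewrite eqr_nat => /eqP.
have lt : fix_set G X < #|G|.+1 by rewrite ltnS fix_set_le.
rewrite /FIX (bigop.bigmax_eq_arg (Ordinal lt)); last first.
  by apply/asboolP; exists X.
by case: arg_maxnP => [|i /asboolP //]; apply/asboolP; exists X.
Qed.

Lemma card_wheel n : #|wheel n.+1| = n.+1.
Proof. by rewrite card_sum !card_ord addn1. Qed.

Lemma card_fan n : #|fan n.+1| = n.+1.
Proof. by rewrite card_sum !card_ord addn1. Qed.

End Extrema.

(* Main.v *)
(* A plane drawing of a wheel or fan restricts the cyclic order in which the rim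
   vertices are seen from the hub: for disjoint rim edges ab and uv, the
   directions of u and v are not separated by those of a and b.  Hence, read
   around the hub from the fixed vertex of least index, the fixed rim vertices
   have monotone indices (wheel) or unimodal indices (fan).

   The given points are assigned to the vertices through independent uniform
   labels.  Only polynomially many cyclic orders of the points are seen from
   points of the plane, as the order depends only on the signs of quadratically
   many affine functionals.  So it is enough that a uniform random word of
   length l has, up to probability exp(- c sqrt n), no increasing subsequence
   longer than 2 sqrt l + eps sqrt n.  Comparing with Hammersley's process with
   sources started from its Bernoulli stationary law, such a subsequence has at
   most as many letters as there are initial particles plus entries through the
   upper end; both are sums of independent variables with mean about sqrt l.
   A unimodal sequence splits into an increasing one on l positions and a
   decreasing one on the other n - l, and
   2 sqrt l + 2 sqrt (n - l) <= 2 sqrt 2 sqrt n. *)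

Require Import Defs.
From mathcomp Require Import all_boot all_order all_algebra.
From mathcomp Require Import zify ring lra.
From mathcomp Require Import boolp classical_sets reals sequences exp.

Set Implicit Arguments.
Unset Strict Implicit.
Unset Printing Implicit Defensive.

Import Order.TTheory GRing.Theory Num.Theory.

Local Open Scope ring_scope.

(** * Weighted sums over words *)

Section WordMean.
Variables (R : realFieldType) (I : finType) (wt : I -> R).

(** The expectation over [n] independent letters once [wt] sums to 1. Recursion on the first letter
    makes conditioning on the first move a computation. *)
Fixpoint word_mean n (F : seq I -> R) : R :=
  if n is n'.+1 then \sum_i wt i * word_mean n' (fun w => F (i :: w))
  else F [::].

Lemma eq_word_mean n F G : F =1 G -> word_mean n F = word_mean n G.
Proof.
elim: n F G => [|n IH] F G FG /=; first exact: FG.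
by apply: eq_bigr => i _; congr (_ * _); apply: IH => w; apply: FG.
Qed.

Lemma word_meanD n F G :
  word_mean n (fun w => F w + G w) = word_mean n F + word_mean n G.
Proof.
elim: n F G => [|n IH] F G //=; rewrite -big_split /=.
by apply: eq_bigr => i _; rewrite IH mulrDr.
Qed.

Lemma word_meanZ n a F : word_mean n (fun w => a * F w) = a * word_mean n F.
Proof.
elim: n F => [|n IH] F //=; rewrite mulr_sumr.
by apply: eq_bigr => i _; rewrite IH mulrCA.
Qed.

Lemma word_mean_sum n (J : finType) (F : J -> seq I -> R) :
  word_mean n (fun w => \sum_j F j w) = \sum_j word_mean n (F j).
Proof.
elim: n F => [|n IH] F //=; rewrite exchange_big /=.
by apply: eq_bigr => i _; rewrite IH mulr_sumr.
Qed.

Lemma word_mean_prod n (h : I -> R) :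
  word_mean n (fun w => \prod_(i <- w) h i) = (\sum_i wt i * h i) ^+ n.
Proof.
elim: n => [|n IH] /=; first by rewrite big_nil.
rewrite exprS mulr_suml; apply: eq_bigr => i _.
rewrite -mulrA; congr (_ * _); rewrite -IH -word_meanZ.
by apply: eq_word_mean => w; rewrite big_cons.
Qed.

Hypothesis wt_ge0 : forall i, 0 <= wt i.

Lemma ler_word_mean n F G : (forall w, size w = n -> F w <= G w) ->
  word_mean n F <= word_mean n G.
Proof.
elim: n F G => [|n IH] F G FG /=; first exact: FG.
apply: ler_sum => i _; apply: ler_wpM2l => //; apply: IH => w sw.
by apply: FG => /=; rewrite sw.
Qed.

Hypothesis wt_sum1 : \sum_i wt i = 1.

Lemma word_mean_cst n a : word_mean n (fun=> a) = a.
Proof.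
elim: n => [|n IH] //=; under eq_bigr do rewrite IH.
by rewrite -mulr_suml wt_sum1 mul1r.
Qed.

Lemma word_mean_take l n F : (l <= n)%N ->
  word_mean n (fun w => F (take l w)) = word_mean l F.
Proof.
elim: n l F => [|n IH] [|l] F //= ln.
  under eq_bigr do rewrite word_mean_cst.
  by rewrite -mulr_suml wt_sum1 mul1r.
by apply: eq_bigr => i _; rewrite (IH l (fun w => F (i :: w))).
Qed.

End WordMean.

Lemma word_mean_tuple (R : realFieldType) (I : finType) (a : R) n (F : seq I -> R) :
  word_mean (fun=> a) n F = a ^+ n * \sum_(w : n.-tuple I) F w.
Proof.
elim: n F => [|n IH] F /=.
  by rewrite mul1r (bigD1 [tuple]) //= big1 ?addr0 // => w; rewrite tuple0.
pose h (p : I * n.-tuple I) := [tuple of p.1 :: p.2].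
rewrite (reindex h) /=; last first.
  exists (fun w : n.+1.-tuple I => (thead w, [tuple of behead w])) => [[i w] _|w _].
    by congr (_, _); apply: val_inj.
  by rewrite [RHS]tuple_eta /h; apply: val_inj.
rewrite -(pair_bigA _ (fun i w => F (i :: tval w))) /= mulr_sumr.
by apply: eq_bigr => i _; rewrite IH exprS mulrA.
Qed.

(** * Hammersley's process with sources *)

(* A state is a list of sites, [true] marking a particle.  A letter [r] pulls
   the next particle above [r] down to [r]; a source removes the lowest
   particle.  The boolean of the result tells that no particle was available,
   i.e. that the move came in through the upper end. *)
Fixpoint kill (s : seq bool) : seq bool * bool :=
  match s with
  | [::] => ([::], true)
  | true :: s' => (false :: s', false)
  | false :: s' => (false :: (kill s').1, (kill s').2)
  end.

Fixpoint ins (r : nat) (s : seq bool) : seq bool * bool :=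
  match r, s with
  | _, [::] => ([::], true)
  | 0%N, true :: s' => (true :: s', false)
  | 0%N, false :: s' => (true :: (kill s').1, (kill s').2)
  | r'.+1, b :: s' => (b :: (ins r' s').1, (ins r' s').2)
  end.

Definition step M s (o : option 'I_M) := if o is Some r then ins r s else kill s.

Fixpoint outs M s (u : seq (option 'I_M)) : nat :=
  if u is o :: u' then ((step s o).2 + outs (step s o).1 u')%N else 0%N.

Lemma count_drop_kill x s :
  (count id (drop x (kill s).1) <= count id (drop x s))%N.
Proof.
elim: s x => [|[] s IH] [|x] //=; try exact: IH.
by have := IH 0%N; rewrite !drop0 !add0n.
Qed.

Lemma count_kill s : (count id (kill s).1).+1 = (count id s + (kill s).2)%N.
Proof. by elim: s => [|[] s IH] //=; rewrite ?add0n ?addn0 ?IH. Qed.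

Lemma count_drop_ins x r s :
  (count id (drop x (ins r s).1) <= count id (drop x s) + (ins r s).2)%N.
Proof.
elim: s r x => [|b s IH] [|r] [|x] //=.
- case: b => //=; first by rewrite addn0.
  by rewrite add1n add0n count_kill.
- case: b => //=; first by rewrite addn0.
  exact: leq_trans (count_drop_kill _ _) (leq_addr _ _).
- by rewrite -addnA leq_add2l; have := IH r 0%N; rewrite !drop0.
Qed.

(** If there is a particle at or above [r], one of them ends at [r] and is not counted from [r.+1]
    on; otherwise the move is charged to the upper end. *)
Lemma count_drop_ins_lt x r s : (x <= r)%N ->
  ((count id (drop r.+1 (ins r s).1)).+1 <=
   count id (drop x s) + (ins r s).2)%N.
Proof.
elim: s r x => [|b s IH] [|r] [|x] //= xr.
- by case: b => /=; rewrite drop0 ?addn0 ?add1n // add0n count_kill.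
- have := IH r 0%N isT; rewrite drop0; lia.
- exact: IH.
Qed.

(** Each letter of the increasing subsequence uses up a particle at or above the bound [x], or an
    entry through the upper end, and then the bound rises past that letter. Any other move adds to
    the particles at or above [x] only through the upper end. *)
Lemma inc_subseq_outs M (u : seq (option 'I_M)) s (x : nat) (t : seq nat) :
  subseq t (map (@nat_of_ord M) (pmap id u)) -> sorted ltn t -> all (leq x) t ->
  (size t <= count id (drop x s) + outs s u)%N.
Proof.
elim: u s x t => [|[r|] u IH] s x t /=.
- by case: t.
- case: t => [|y t] //= st yt /andP[xy xt].
  case: (eqVneq y r) st => [yr st|_ st].
    rewrite yr in xy yt.
    have ut : all (leq r.+1) t by exact: (order_path_min ltn_trans yt).
    have := IH (ins r s).1 r.+1 t st (path_sorted yt) ut.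
    by have := count_drop_ins_lt s xy; lia.
  have := IH (ins r s).1 x (y :: t) st yt; rewrite /= xy xt => /(_ isT).
  by have := count_drop_ins x r s; lia.
- move=> st yt xt; have := IH (kill s).1 x t st yt xt.
  by have := count_drop_kill x s; lia.
Qed.

Section Stationarity.
Variables (R : realFieldType) (beta : R) (z : R).

Definition bern_wt (b : bool) : R := if b then beta else 1 - beta.

Lemma sum_bern_wt : \sum_b bern_wt b = 1.
Proof. by rewrite big_bool /=; ring. Qed.

Local Notation mu := (word_mean bern_wt).

(** Induction on the number of sites, grouping by the state of the lowest site after the move. A
    letter that fills the empty lowest site acts as a source on the sites above, so given either
    final state these sites again see each letter with weight [beta] and a source with weight
    [1 - beta]. The remaining moves, which find the lowest site occupied, leave the law of the rest
    unchanged. *)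
Lemma bern_stationary M (g : seq bool -> R) :
  beta * \sum_(r < M) mu M (fun s => z ^+ (ins r s).2 * g (ins r s).1) +
  (1 - beta) * mu M (fun s => z ^+ (kill s).2 * g (kill s).1) =
  (beta * M%:R + (1 - beta) * z) * mu M g.
Proof.
elim: M g => [|M IH] g; first by rewrite big_ord0 /=; ring.
have := IH (fun s => g (true :: s)); have := IH (fun s => g (false :: s)).
rewrite big_ord_recl /= !big_bool /=.
under [X in _ -> _ -> _ * (_ + X) + _ = _]eq_bigr do rewrite big_bool /=.
rewrite big_split /= -!mulr_sumr.
have E1 b : mu M (fun w => z ^+ 0 * g (b :: w)) = mu M (fun w => g (b :: w)).
  by apply: eq_word_mean => w; rewrite mul1r.
have E2 b :
  \sum_(i < M) mu M
    (fun w => z ^+ (ins (0 + i) w).2 * g (b :: (ins (0 + i) w).1)) =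
  \sum_(i < M) mu M (fun w => z ^+ (ins i w).2 * g (b :: (ins i w).1)) by [].
rewrite !E1 !E2.
rewrite -[M.+1%:R]natr1.
set a0 := \sum_(r < M) _; set a1 := \sum_(r < M) _.
set k1 := mu M (fun s => _ * g (true :: _)).
set k0 := mu M (fun s => _ * g (false :: _)).
move=> e0 e1.
transitivity ((1 - beta) * (beta * a0 + (1 - beta) * k0) +
  beta * (beta * a1 + (1 - beta) * k1) +
  beta * (beta * mu M (fun s => g (true :: s)) +
          (1 - beta) * mu M (fun s => g (false :: s)))).
  ring.
rewrite e0 e1; ring.
Qed.

Variable M : nat.
Hypothesis beta_gt0 : 0 < beta.
Hypothesis beta_lt1 : beta < 1.
Hypothesis M_gt0 : (0 < M)%N.

Definition src_prob : R := (1 - beta) / (beta * M%:R + (1 - beta)).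

Definition letter_wt (o : option 'I_M) : R :=
  if o is Some _ then beta / (beta * M%:R + (1 - beta)) else src_prob.

Let den_gt0 : 0 < beta * M%:R + (1 - beta).
Proof. by rewrite addr_gt0 ?subr_gt0 // mulr_gt0 ?ltr0n. Qed.

Lemma letter_wt_ge0 o : 0 <= letter_wt o.
Proof. by case: o => [r|]; apply: divr_ge0; rewrite ?subr_ge0 ltW. Qed.

Lemma big_option (S : zmodType) (I : finType) (F : option I -> S) :
  \sum_o F o = F None + \sum_i F (Some i).
Proof.
rewrite (bigD1 None) //=; congr (_ + _).
rewrite (reindex_omap Some id) => [|[i|]] //=.
by apply: eq_bigl => i; rewrite eqxx.
Qed.

Lemma sum_letter_wt : \sum_o letter_wt o = 1.
Proof.
rewrite big_option /= sumr_const card_ord /src_prob -[_ *+ M]mulr_natr.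
by field; rewrite gt_eqF.
Qed.

(** A Burke property: from the stationary law, the entries through the upper end are as numerous as
    independent trials with success probability [src_prob], the rate of sources. *)
Lemma outs_mgf T :
  mu M (fun s => word_mean letter_wt T (fun u => z ^+ outs s u)) =
  (1 + src_prob * (z - 1)) ^+ T.
Proof.
elim: T => [|T IH] /=; first by rewrite word_mean_cst // sum_bern_wt.
pose g s := word_mean letter_wt T (fun u => z ^+ outs s u).
rewrite (@eq_word_mean _ _ _ _ _
  (fun s => src_prob * (z ^+ (kill s).2 * g (kill s).1) +
     beta / (beta * M%:R + (1 - beta)) *
       \sum_(r < M) z ^+ (ins r s).2 * g (ins r s).1)); last first.
  move=> s; rewrite big_option /= mulr_sumr; congr (_ * _ + _).
    by rewrite -word_meanZ; apply: eq_word_mean => u; rewrite exprD.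
  apply: eq_bigr => r _; congr (_ * _).
  by rewrite -word_meanZ; apply: eq_word_mean => u; rewrite exprD.
rewrite word_meanD !word_meanZ word_mean_sum.
have := bern_stationary M g; rewrite IH.
set a := \sum_(r < M) _; set k := mu M _ => e.
have den0 : beta * M%:R + (1 - beta) != 0 by rewrite gt_eqF.
transitivity ((beta * a + (1 - beta) * k) / (beta * M%:R + (1 - beta))).
  by rewrite /src_prob; field.
by rewrite e exprS /src_prob; field.
Qed.

End Stationarity.

(** * Tail bound for increasing subsequences of a uniform word *)

Definition has_inc (k : nat) (w : seq nat) : bool :=
  `[< exists t, [/\ subseq t w, sorted ltn t & (k <= size t)%N] >].

Section LISTail.
Variables (R : realFieldType) (beta : R) (M : nat).
Hypotheses (beta_gt0 : 0 < beta) (beta_lt1 : beta < 1) (M_gt0 : (0 < M)%N).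

Local Notation mu := (word_mean (bern_wt beta)).
Local Notation run := (word_mean (letter_wt beta (M := M))).
Local Notation unif := (word_mean (fun _ : 'I_M => M%:R^-1 : R)).
Local Notation q := (src_prob beta M).

Lemma sum_unif_wt : \sum_(i < M) M%:R^-1 = 1 :> R.
Proof.
by rewrite sumr_const card_ord -[_ *+ M]mulr_natr mulVf // pnatr_eq0 -lt0n.
Qed.

(** A move that is not a source is a uniform letter, whatever the positions of the sources. So the
    first [n] letters are uniform and independent of the event that [n] letters occur. *)
Lemma run_letters T n (phi : seq 'I_M -> R) :
  run T (fun u => (n <= size (pmap id u))%:R * phi (take n (pmap id u))) =
  unif n phi * run T (fun u => (n <= size (pmap id u))%:R).
Proof.
have M0 : M%:R != 0 :> R by rewrite pnatr_eq0 -lt0n.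
have all0 (psi : seq 'I_M -> R) T' :
    run T' (fun u => (0 <= size (pmap id u))%:R * psi (take 0 (pmap id u))) =
    psi [::] * run T' (fun u => (0 <= size (pmap id u))%:R).
  rewrite -word_meanZ; apply: eq_word_mean => u.
  by rewrite take0 leq0n mul1r mulr1.
elim: T n phi => [|T IH] [|n] phi; first exact: all0.
- by rewrite /= mul0r mulr0.
- exact: all0.
rewrite /= !big_option /= IH mulrDr mulrCA; congr (_ + _).
under eq_bigr do rewrite (IH n (fun w => phi (_ :: w))).
rewrite -mulr_sumr sumr_const card_ord -[_ *+ M]mulr_natr -mulr_sumr -mulr_suml.
by field; rewrite M0 andbT gt_eqF // addr_gt0 ?subr_gt0 // mulr_gt0 ?ltr0n.
Qed.

Definition nsrc (u : seq (option 'I_M)) := count (pred1 None) u.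

Lemma size_pmap_nsrc u : (size (pmap id u) + nsrc u)%N = size u.
Proof. by elim: u => [|[r|] u IH] //=; rewrite /nsrc /= in IH *; lia. Qed.

Lemma run_nsrc T : run T (fun u => (nsrc u)%:R) = T%:R * q.
Proof.
have w1 := sum_letter_wt beta_gt0 beta_lt1 M_gt0.
elim: T => [|T IH]; first by rewrite /= mul0r.
rewrite -natr1 mulrDl mul1r -IH.
transitivity ((\sum_(o : option 'I_M) letter_wt beta o) *
  run T (fun u => (nsrc u)%:R) + q); last first.
  by rewrite w1 mul1r.
rewrite mulr_suml.
rewrite [LHS]/= !big_option addrAC; congr (_ + _).
rewrite (@eq_word_mean _ _ _ _ _ (fun u => 1 + (nsrc u)%:R)); last first.
  by move=> u; rewrite nat1r.
by rewrite word_meanD word_mean_cst // mulrDr mulr1 addrC.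
Qed.

(** Markov's inequality: fewer than [n] letters in [n + t] moves means at least [t.+1] sources. *)
Lemma run_enough_letters n t :
  1 - (n + t)%:R * q / t.+1%:R <=
  run (n + t) (fun u => (n <= size (pmap id u))%:R).
Proof.
have w1 := sum_letter_wt beta_gt0 beta_lt1 M_gt0.
rewrite lerBlDr -run_nsrc mulrC -word_meanZ -word_meanD.
rewrite -[leLHS](word_mean_cst w1 (n + t)).
apply: ler_word_mean => [o|u su]; first exact: letter_wt_ge0.
have := size_pmap_nsrc u; rewrite su; move: (size (pmap _ _)) => a.
case: leqP => [_ _|lt e]; first by rewrite lerDl mulr_ge0 // invr_ge0.
by rewrite add0r mulrC ler_pdivlMr ?ltr0n // mul1r ler_nat; lia.
Qed.

Lemma bern_mgf z : mu M (fun s => z ^+ count id s) = (1 + beta * (z - 1)) ^+ M.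
Proof.
transitivity (mu M (fun s => \prod_(b <- s) z ^+ (b : bool))).
  apply: eq_word_mean => s; elim: s => [|b s IH]; first by rewrite big_nil.
  by rewrite big_cons -IH /= exprD.
by rewrite word_mean_prod big_bool /=; congr (_ ^+ _); rewrite expr1 expr0; ring.
Qed.

(** A subsequence of length [k1 + k2] needs [k1] initial particles or [k2] entries through the upper
    end. Each indicator is bounded by [z] to the excess, and the two means are known exactly. *)
Lemma has_inc_tail z n t k1 k2 : 1 <= z ->
  unif n (fun w => (has_inc (k1 + k2) (map (@nat_of_ord M) w))%:R) *
    (1 - (n + t)%:R * q / t.+1%:R) <=
  (1 + beta * (z - 1)) ^+ M / z ^+ k1 + (1 + q * (z - 1)) ^+ (n + t) / z ^+ k2.
Proof.
move=> z1.
have w1 := sum_letter_wt beta_gt0 beta_lt1 M_gt0.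
have w0 := letter_wt_ge0 beta_gt0 beta_lt1 M_gt0.
have b1 := sum_bern_wt beta.
have b0 b : 0 <= bern_wt beta b by case: b; rewrite /= ?subr_ge0 ltW.
have z0 : 0 < z by exact: lt_le_trans z1.
set phi := fun w : seq 'I_M => _.
have phi0 : 0 <= unif n phi.
  rewrite -[leLHS](word_mean_cst sum_unif_wt n); apply: ler_word_mean => [i|w _].
    by rewrite invr_ge0.
  by rewrite /phi ler0n.
apply: le_trans (ler_wpM2l phi0 (run_enough_letters n t)) _.
rewrite -run_letters -[leLHS](word_mean_cst b1 M).
rewrite -bern_mgf -(outs_mgf z beta_gt0 beta_lt1 M_gt0).
rewrite mulrC -word_meanZ [X in _ + X]mulrC -word_meanZ -word_meanD.
apply: ler_word_mean => // s _.
rewrite -word_meanZ -[X in _ <= X + _](word_mean_cst w1 (n + t)) -word_meanD.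
apply: ler_word_mean => // u _.
have p1 : 0 <= (z ^+ k1)^-1 * z ^+ count id s.
  by rewrite mulr_ge0 ?invr_ge0 // exprn_ge0 // ltW.
have p2 : 0 <= (z ^+ k2)^-1 * z ^+ outs s u.
  by rewrite mulr_ge0 ?invr_ge0 // exprn_ge0 // ltW.
case: leqP => nu; last by rewrite mul0r addr_ge0.
rewrite mul1r /phi /has_inc; case: asboolP => [[v [vu vs kv]]|_]; last by rewrite addr_ge0.
have vu' : subseq v (map (@nat_of_ord M) (pmap id u)).
  by apply: subseq_trans vu _; rewrite map_subseq // take_subseq.
have v0 : all (leq 0) v by apply/allP.
have := inc_subseq_outs s vu' vs v0.
rewrite drop0 => le.
have [k1s|k1s] := leqP k1 (count id s).
  apply: ler_wpDr => //; rewrite mulrC ler_pdivlMr ?exprn_gt0 // mul1r.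
  exact: ler_weXn2l.
apply: ler_wpDl => //; rewrite mulrC ler_pdivlMr ?exprn_gt0 // mul1r.
apply: ler_weXn2l => //; move: kv le k1s.
by move: (size v) (count id s) (outs s u) => ? ? ?; lia.
Qed.

End LISTail.

(** Exponential Markov bound with [x = delta / 4]. From [1 + p * x <= expR (p * x)] and
    [(1 + x)^-1 = 1 - y <= expR (- y)], the gain is [y * (delta * S)], and the second-order loss
    [y * (kappa * x)] is at most half of it. *)
Lemma chernoff (R : realType) (p S kappa delta : R) (N k : nat) :
  0 <= p -> 0 < delta <= 1 -> 0 <= S ->
  p * N%:R <= kappa -> kappa <= 2 * S -> kappa + delta * S <= k%:R ->
  (1 + p * (delta / 4)) ^+ N / (1 + delta / 4) ^+ k <=
  expR (- (delta ^+ 2 / 16 * S)).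
Proof.
move=> p0 /andP[d0 d1] S0 pN kS kk.
set x := delta / 4; have x0 : 0 < x by rewrite /x; lra.
have px0 : 0 <= p * x by rewrite mulr_ge0 // ltW.
have le1 : (1 + p * x) ^+ N <= expR (p * x * N%:R).
  by rewrite expRM_natr; apply: lerXn2r; rewrite ?nnegrE ?expR_ge0 ?expR_ge1Dx // addr_ge0.
set y := x / (1 + x).
have xy : x = y * (1 + x) by rewrite /y; field; lra.
have y0 : delta / 8 <= y.
  by rewrite /y ler_pdivlMr /x; nra.
have le2 : (1 + x) ^- k <= expR (- y * k%:R).
  rewrite expRM_natr -exprVn; apply: lerXn2r; rewrite ?nnegrE ?expR_ge0 ?invr_ge0 //; first lra.
  apply: le_trans (expR_ge1Dx _); rewrite /y le_eqVlt; apply/orP; left.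
  by apply/eqP; field; lra.
apply: le_trans (ler_pM _ _ le1 le2) _.
- by rewrite exprn_ge0 // addr_ge0.
- by rewrite invr_ge0 exprn_ge0 //; lra.
rewrite -expRD ler_expR.
have h1 : p * x * N%:R <= kappa * x.
  by rewrite mulrAC ler_wpM2r // ltW.
have h2 : y * (kappa + delta * S) <= y * k%:R by apply: ler_wpM2l => //; lra.
have h3 : kappa * x <= 2 * S * x by apply: ler_wpM2r => //; exact: ltW.
have h4 : delta / 8 * (delta * S) <= y * (delta * S).
  by apply: ler_wpM2r => //; rewrite mulr_ge0 // ltW.
have h5 : y * (kappa * x) <= y * (2 * S * x) by apply: ler_wpM2l => //; lra.
have h6 : kappa * x = y * kappa + y * (kappa * x) by rewrite {1}xy; ring.
have h7 : y * (2 * S * x) = y * (delta * S) / 2 by rewrite /x; field.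
rewrite mulNr. rewrite mulrDr in h2.
have h8 : delta / 8 * (delta * S) = 2 * (delta ^+ 2 / 16 * S) by field.
lra.
Qed.

Lemma has_inc_word_tail (R : realType) (delta : R) (n M l k : nat) :
  0 < delta <= 1 -> 5 <= delta ^+ 2 * Num.sqrt n%:R -> (n ^ 2 <= M)%N ->
  (l <= n)%N ->
  Num.sqrt l%:R + 2 * delta * Num.sqrt n%:R <= k%:R ->
  word_mean (fun _ : 'I_M => M%:R^-1) n
    (fun w => (has_inc (k + k) (map (@nat_of_ord M) (take l w)))%:R) <=
  4 * expR (- (delta ^+ 2 / 16 * Num.sqrt n%:R)).
Proof.
move=> d01; have /andP[d0 d1] := d01.
set S := Num.sqrt n%:R; set s := Num.sqrt l%:R => dS nM ln sk.
have s0 : 0 <= s by exact: sqrtr_ge0.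
have sS : s <= S by apply: ler_wsqrtr; rewrite ler_nat.
have ss : s * s = l%:R by rewrite -expr2 sqr_sqrtr.
have SS : S * S = n%:R by rewrite -expr2 sqr_sqrtr.
have S_ge0 : 0 <= S by exact: sqrtr_ge0.
have d2 : delta ^+ 2 <= delta by rewrite expr2; nra.
have dS' : 5 <= delta * S by apply: le_trans dS _; apply: ler_wpM2r.
have S5 : 5 <= S by nra.
have S0 : 0 < S by lra.
have MS : S * S * (S * S) <= M%:R.
  by rewrite SS -natrM ler_nat mulnn.
(* [m] is the mean number of initial particles. The summand [delta * S] keeps it away from 0 for
   small [l] and pays for the extra moves chosen below. *)
set m := s + delta * S; have mS : m <= 2 * S by rewrite /m; nra.
have m4 : 4 <= m by rewrite /m; lra.
have S2 : 5 * S <= S * S by nra.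
have S4 : 25 * (S * S) <= S * S * (S * S) by nra.
have M0R : 2 * S < M%:R by lra.
have M0 : (0 < M)%N by rewrite -(ltr0n R); lra.
set beta := m / M%:R.
have beta0 : 0 < beta by rewrite divr_gt0 ?ltr0n //; lra.
have beta1 : beta < 1 by rewrite ltr_pdivrMr ?ltr0n //; lra.
have betaM : beta * M%:R = m by rewrite /beta mulfVK // pnatr_eq0 -lt0n.
have qm : src_prob beta M <= m^-1.
  rewrite /src_prob betaM ler_pdivrMr; last by lra.
  by rewrite mulrC ler_pdivlMr; nra.
have q0 : 0 <= src_prob beta M.
  by exact: (letter_wt_ge0 beta0 beta1 M0 None).
have S40 : 0 <= 4 * S by lra.
have /andP[t1 t2] := truncn_itv S40.
(* With [t.+1] extra moves, about [4 * S], the mean number of sources is at most half of [t.+2].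
   Still [l + t.+1 <= m * m], because [5 <= delta ^+ 2 * S]. *)
move: t1 t2; set t := (Num.trunc (4 * S)) => t1 t2.
have qmm : src_prob beta M * m <= 1.
  by rewrite -[leRHS](mulVf (_ : m != 0)) ?ler_wpM2r //; lra.
have Tq : src_prob beta M * (l + t.+1)%:R <= m.
  have h : src_prob beta M * (l + t.+1)%:R * m <= (l + t.+1)%:R.
    by rewrite mulrAC -[leRHS]mul1r ler_wpM2r.
  have h' : (l + t.+1)%:R <= m * m.
    rewrite natrD -natr1 -ss /m; nra.
  rewrite -(ler_pM2r (_ : 0 < m)); lra.
rewrite (word_mean_take (sum_unif_wt R M0) (fun w =>
  (has_inc (k + k) (map (@nat_of_ord M) w))%:R) ln).
have z1 : 1 <= 1 + delta / 4 by lra.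
have := has_inc_tail beta0 beta1 M0 l t.+1 k k z1.
set a := word_mean _ _ _.
have a0 : 0 <= a.
  rewrite -[leLHS](word_mean_cst (sum_unif_wt R M0) l); apply: ler_word_mean => [i|w _].
    by rewrite invr_ge0.
  by rewrite ler0n.
(* Enough letters occur with probability at least 1/2; this turns the two Chernoff terms into the
   final factor 4. *)
have half : 1 / 2 <= 1 - (l + t.+1)%:R * src_prob beta M / t.+2%:R.
  rewrite lerBrDr -lerBrDl ler_pdivrMr ?ltr0n // mulrC.
  apply: le_trans Tq _; rewrite -[t.+2%:R]natr1; lra.
rewrite addrAC subrr add0r => tail.
have mk : m + delta * S <= k%:R by rewrite /m; lra.
have Mq : beta * M%:R <= m by rewrite betaM.
have c1 := chernoff (ltW beta0) d01 (ltW S0) Mq mS mk.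
have c2 := chernoff q0 d01 (ltW S0) Tq mS mk.
have le : a * (1 / 2) <= a * (1 - (l + t.+1)%:R * src_prob beta M / t.+2%:R).
  exact: ler_wpM2l.
have := le_trans (le_trans le tail) (lerD c1 c2).
by move: (expR _) => e; clear; lra.
Qed.

(** * Sign patterns of affine functionals *)

Section SignClasses.
Variable R : realType.
Implicit Types (p q r : R * R) (f g : R * R * R) (A : set (R * R)).

Definition aff f p : R := f.1.1 * p.1 + f.1.2 * p.2 + f.2.

Definition same_signs fs p q :=
  all (fun f => Num.sg (aff f p) == Num.sg (aff f q)) fs.

Definition on_seg p q (t : R) : R * R :=
  ((1 - t) * p.1 + t * q.1, (1 - t) * p.2 + t * q.2).

Lemma aff_on_seg f p q t :
  aff f (on_seg p q t) = (1 - t) * aff f p + t * aff f q.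
Proof. by rewrite /aff /=; ring. Qed.

Definition convex_set A :=
  forall p q t, A p -> A q -> 0 <= t <= 1 -> A (on_seg p q t).

Lemma sg_convex (x y t : R) : Num.sg x = Num.sg y -> 0 <= t <= 1 ->
  Num.sg ((1 - t) * x + t * y) = Num.sg x.
Proof.
move=> e /andP[t0 t1].
have [x0|x0|x0] := sgrP x; rewrite -?x0.
- have y0 : y = 0 by apply/eqP; rewrite -sgr_eq0 -e x0 sgr0.
  by rewrite x0 y0 !mulr0 addr0 sgr0.
- have y0 : 0 < y by rewrite -sgr_gt0 -e sgr_gt0.
  by apply/eqP; rewrite sgr_cp0; nra.
- have y0 : y < 0 by rewrite -sgr_lt0 -e sgr_lt0.
  by apply/eqP; rewrite sgr_cp0; nra.
Qed.

Lemma same_signs_trans fs p q r :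
  same_signs fs p q -> same_signs fs q r -> same_signs fs p r.
Proof.
by move=> /allP pq /allP qr; apply/allP => f fs'; rewrite (eqP (pq f fs')) qr.
Qed.

Lemma same_signs_sym fs p q : same_signs fs p q = same_signs fs q p.
Proof. by apply: eq_all => f; rewrite eq_sym. Qed.

Lemma same_signs_seg fs p q t : same_signs fs p q -> 0 <= t <= 1 ->
  same_signs fs p (on_seg p q t).
Proof.
move=> /allP pq t01; apply/allP => f ffs.
by rewrite aff_on_seg sg_convex // (eqP (pq f ffs)).
Qed.

Lemma affine_root (x y : R) : Num.sg x != Num.sg y ->
  exists2 t, 0 <= t <= 1 & (1 - t) * x + t * y = 0.
Proof.
move=> ne; have xy : x - y != 0.
  by apply: contra_neq ne => /eqP; rewrite subr_eq0 => /eqP ->.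
exists (x / (x - y)); last by field.
move: ne; case: (sgrP x) => [->|x0|x0]; case: (sgrP y) => [->|y0|y0] //;
  rewrite ?eqxx ?mul0r ?subr0 ?ler01 ?lexx // => _.
- by rewrite divff ?lexx ?ler01 // gt_eqF.
- by rewrite divr_ge0 ?ler_pdivrMr ?mul1r; lra.
- by rewrite divff ?lexx ?ler01 // lt_eqF.
- rewrite -mulrNN -invrN divr_ge0 ?ler_pdivrMr ?mul1r; lra.
Qed.

(* [flat d A]: the affine span of [A] has dimension at most [d]. *)
Fixpoint flat d A : Prop :=
  if d is d'.+1 then
    forall f, (forall p, A p -> aff f p = 0) \/
              flat d' (A `&` [set p | aff f p = 0])%classic
  else forall p q, A p -> A q -> p = q.

Definition sign_reps A (fs : seq (R * R * R)) (cs : seq (R * R)) :=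
  (forall q, q \in cs -> A q) /\
  forall p, A p -> exists2 q, q \in cs & same_signs fs p q.

Lemma convex_set_kernel A f :
  convex_set A -> convex_set (A `&` [set p | aff f p = 0])%classic.
Proof.
move=> cA p q t [Ap fp] [Aq fq] t01; split; first exact: cA.
by rewrite /= aff_on_seg fp fq !mulr0 addr0.
Qed.

(* Only the sign classes that the line [f = 0] meets are cut by it, since a
   sign class is convex. *)
Lemma sign_reps_cons A f fs cs ds : convex_set A ->
  sign_reps A fs cs ->
  sign_reps (A `&` [set p | aff f p = 0])%classic fs ds ->
  exists2 es, sign_reps A (f :: fs) es & size es = (size cs + 3 * size ds)%N.
Proof.
move=> cA [csA cs_rep] [dsA ds_rep].
have pick d s : exists q, A d -> A q /\
    ((exists q, [/\ A q, same_signs fs d q & Num.sg (aff f q) = s]) ->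
     same_signs fs d q /\ Num.sg (aff f q) = s).
  have [[q [Aq dq fq]]|nex] :=
    pselect (exists q, [/\ A q, same_signs fs d q & Num.sg (aff f q) = s]).
    by exists q.
  by exists d => Ad; split.
have [ch chP] := choice (fun ds : (R * R) * R => pick ds.1 ds.2).
(* The old representatives, those on the line [f = 0], and for each of the latter a point of its
   class on either side of the line, if there is one. *)
exists (cs ++ ds ++ [seq ch (d, 1) | d <- ds] ++ [seq ch (d, -1) | d <- ds]); last first.
  by rewrite !size_cat !size_map; lia.
split=> [q|p Ap].
  rewrite !mem_cat => /or4P[/csA|/dsA[]|/mapP[d /dsA[Ad _] ->]|/mapP[d /dsA[Ad _] ->]] //.
    exact: (chP (d, 1) Ad).1.
  exact: (chP (d, -1) Ad).1.
have [q qcs pq] := cs_rep p Ap.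
have [fpq|fpq] := eqVneq (Num.sg (aff f p)) (Num.sg (aff f q)).
  by exists q; rewrite ?mem_cat ?qcs //= fpq eqxx.
(* The segment from [p] to [q] stays in one class for [fs] and meets [f = 0]; the representative of
   the meeting point leads to the side of [p]. *)
have [t t01 ft] := affine_root fpq.
have [|d dds rd] := ds_rep (on_seg p q t).
  by split; [apply: cA => //; exact: csA|rewrite /= aff_on_seg].
have pd := same_signs_trans (same_signs_seg pq t01) rd.
have [Ad fd] := dsA d dds.
have [fp|fp] := eqVneq (aff f p) 0.
  by exists d; rewrite ?mem_cat ?dds ?orbT //= fp fd eqxx.
have [_ /(_ _)] := chP (d, Num.sg (aff f p)) Ad.
move=> /= [|dp fch]; first by exists p; split=> //; rewrite same_signs_sym.
exists (ch (d, Num.sg (aff f p))); last first.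
  by rewrite /= fch eqxx; exact: same_signs_trans dp.
rewrite !mem_cat; have [f0|_|_] := sgrP (aff f p).
- by rewrite f0 eqxx in fp.
- by rewrite map_f ?orbT.
- by rewrite map_f ?orbT.
Qed.

(** Induction on the functionals: a new one adds three times the classes of its zero set, which has
    one dimension less, and [(1 + 3 * k) ^ d.+1 + 3 * (1 + 3 * k) ^ d <= (1 + 3 * k.+1) ^ d.+1]. *)
Lemma sign_reps_exist d A fs : convex_set A -> flat d A ->
  exists2 cs, sign_reps A fs cs & (size cs <= (1 + 3 * size fs) ^ d)%N.
Proof.
have small (d' : nat) B gs : (forall p q, B p -> B q -> same_signs gs p q) ->
    exists2 cs, sign_reps B gs cs & (size cs <= (1 + 3 * size gs) ^ d')%N.
  move=> BB; have [[p0 Bp0]|nB] := pselect (exists p, B p).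
    exists [:: p0]; last by rewrite expn_gt0.
    split=> [q|p Bp]; first by rewrite inE => /eqP ->.
    by exists p0; rewrite ?inE // BB.
  exists [::] => //; split=> // p Bp; case: nB; by exists p.
elim: fs d A => [|f fs IH] [|d] A cA fA.
- exact: small.
- exact: small.
- by apply: small => p q Ap Aq; rewrite (fA p q Ap Aq); apply/allP => g _.
have [cs csP cs_le] := IH d.+1 A cA fA.
case: (fA f) => [f0|fA'].
  exists cs; last first.
    by apply: leq_trans cs_le _; rewrite leq_exp2r //= mulnS; lia.
  split=> [|p Ap]; first exact: csP.1.
  have [q qcs pq] := csP.2 p Ap; exists q => //=.
  by rewrite !f0 ?eqxx //; exact: csP.1.
have [ds dsP ds_le] := IH d _ (@convex_set_kernel A f cA) fA'.
have [es esP es_sz] := sign_reps_cons cA csP dsP.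
exists es => //; rewrite es_sz.
apply: (@leq_trans ((1 + 3 * size fs) ^ d.+1 + 3 * (1 + 3 * size fs) ^ d)).
  by rewrite leq_add // leq_mul2l.
rewrite expnS -mulnDl [X in (_ <= X)%N]expnS.
apply: leq_mul; first by rewrite /= mulnS; lia.
by case: (d) => [//|d']; rewrite leq_exp2r //= mulnS; lia.
Qed.

(** Two distinct common zeros of [f] and [g] span the line [f = 0], so [g] vanishes on all of it;
    otherwise at most one common zero is left. *)
Lemma flat_plane : flat 2 (@setT (R * R)).
Proof.
move=> f; have [f0|nf0] := pselect (forall p, aff f p = 0); first by left=> p _.
right=> g.
have [g0|ng0] := pselect (forall p, aff f p = 0 -> aff g p = 0).
  by left=> p [_ /g0].
right=> p q [[_ fp] gp] [[_ fq] gq]; apply: contrapT => pq.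
apply: ng0 => r fr.
move: fp gp fq gq fr pq nf0; rewrite /= /aff.
case: f => -[a b] c; case: g => -[a' b'] c'; case: p q r => [p1 p2] [q1 q2] [r1 r2] /=.
move=> fp gp fq gq fr pq nf0.
have ab : (a != 0) || (b != 0).
  apply: contrapT => /negP; rewrite negb_or !negbK => /andP[/eqP a0 /eqP b0].
  apply: nf0 => -[x y] /=; move: fp; rewrite a0 b0; lra.
have e1 : a * (p1 - q1) + b * (p2 - q2) = 0.
  by rewrite -[RHS](subrr 0) -{1}fp -fq; ring.
have e2 : a * (r1 - q1) + b * (r2 - q2) = 0.
  by rewrite -[RHS](subrr 0) -{1}fr -fq; ring.
have e3 : (p1 - q1) * (r2 - q2) - (p2 - q2) * (r1 - q1) = 0.
  case/orP: ab => [a0|b0].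
    apply: (mulfI a0); rewrite mulr0.
    transitivity ((r2 - q2) * (a * (p1 - q1) + b * (p2 - q2)) -
                  (p2 - q2) * (a * (r1 - q1) + b * (r2 - q2))); first ring.
    by rewrite e1 e2 !mulr0 subrr.
  apply: (mulfI b0); rewrite mulr0.
  transitivity ((p1 - q1) * (a * (r1 - q1) + b * (r2 - q2)) -
                (r1 - q1) * (a * (p1 - q1) + b * (p2 - q2))); first ring.
  by rewrite e1 e2 !mulr0 subrr.
have e4 : a' * (p1 - q1) + b' * (p2 - q2) = 0.
  by rewrite -[RHS](subrr 0) -{1}gp -gq; ring.
suff e5 : a' * (r1 - q1) + b' * (r2 - q2) = 0.
  by move: e5 gq; rewrite !mulrBr; lra.
have [p1q1|p1q1] := eqVneq (p1 - q1) 0.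
  have [p2q2|p2q2] := eqVneq (p2 - q2) 0.
    by case: pq; congr (_, _); apply/eqP; rewrite -subr_eq0 ?p1q1 ?p2q2.
  apply: (mulfI p2q2); rewrite mulr0.
  transitivity ((r2 - q2) * (a' * (p1 - q1) + b' * (p2 - q2)) -
    a' * ((p1 - q1) * (r2 - q2) - (p2 - q2) * (r1 - q1))); first ring.
  by rewrite e3 e4 !mulr0 subrr.
apply: (mulfI p1q1); rewrite mulr0.
transitivity ((r1 - q1) * (a' * (p1 - q1) + b' * (p2 - q2)) +
  b' * ((p1 - q1) * (r2 - q2) - (p2 - q2) * (r1 - q1))); first ring.
by rewrite e3 e4 !mulr0 addr0.
Qed.

Lemma plane_sign_reps (fs : seq (R * R * R)) : exists cs : seq (R * R),
  (size cs <= (1 + 3 * size fs) ^ 2)%N /\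
  forall p, exists2 q, q \in cs & same_signs fs p q.
Proof.
have [|cs [_ csP] cs_le] := @sign_reps_exist 2 setT fs _ flat_plane; first by [].
by exists cs; split=> // p; exact: csP.
Qed.

End SignClasses.

(** * Angular order of vectors *)

Section Angles.
Variable R : realType.
Implicit Types (a b u v : R * R).

Definition cross u v : R := u.1 * v.2 - u.2 * v.1.

Definition low u : bool := (u.2 < 0) || ((u.2 == 0) && (u.1 < 0)).

(* Comparison of the polar angles in [0, 2pi); [low] selects [pi, 2pi). *)
Definition ang_le u v :=
  (~~ low u && low v) || ((low u == low v) && (0 <= cross u v)).

Definition ang_lt u v :=
  (~~ low u && low v) || ((low u == low v) && (0 < cross u v)).

Definition same_dir u v := (low u == low v) && (cross u v == 0).

Lemma crossC u v : cross u v = - cross v u.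
Proof. by rewrite /cross; ring. Qed.

Lemma ang_lt_le u v : ~~ same_dir u v -> ang_lt u v = ang_le u v.
Proof.
rewrite /same_dir /ang_lt /ang_le; case: (low u == low v) => //= ne.
by rewrite lt_def ne.
Qed.

Lemma ang_ltNge u v : ~~ same_dir u v -> ang_lt u v = ~~ ang_lt v u.
Proof.
rewrite /same_dir /ang_lt eq_sym (crossC u v) oppr_eq0 oppr_gt0 => sd.
case: (low u) (low v) sd => -[] //= c0; rewrite -leNgt le_eqVlt;
  by rewrite (negbTE c0).
Qed.

Lemma ang_le_total : total ang_le.
Proof.
move=> u v; rewrite /ang_le (crossC v u) oppr_ge0.
by case: (low u) (low v) => -[] //=; exact: le_total.
Qed.

Lemma low_cone u : u != (0, 0) ->
  if low u then (u.2 < 0) || ((u.2 == 0) && (u.1 < 0))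
  else (0 < u.2) || ((u.2 == 0) && (0 < u.1)).
Proof.
case: u => x y; rewrite xpair_eqE /low /=.
by case: (ltgtP y 0) => //= _; case: (ltgtP x 0).
Qed.

Lemma ang_le_trans :
  {in [pred u : R * R | u != (0, 0)] & &, transitive ang_le}.
Proof.
move=> v u w; rewrite !inE => /low_cone v0 /low_cone u0 /low_cone w0.
rewrite /ang_le.
move: u0 v0 w0; case: (low u) (low v) (low w) => -[] [] //= u0 v0 w0 uv vw;
  move: u v w u0 v0 w0 uv vw => [u1 u2] [v1 v2] [w1 w2] /= + + + ; rewrite /cross /=.
  case/orP => [u0|/andP[/eqP -> u0]]; case/orP => [v0|/andP[/eqP -> v0]];
    case/orP => [w0|/andP[/eqP -> w0]] => uv vw; nra.
case/orP => [u0|/andP[/eqP -> u0]]; case/orP => [v0|/andP[/eqP -> v0]];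
  case/orP => [w0|/andP[/eqP -> w0]] => uv vw; nra.
Qed.

Lemma low_scale (k : R) u : k != 0 -> u != (0, 0) ->
  low (k * u.1, k * u.2) = low u (+) (k < 0).
Proof.
case: u => x y k0; rewrite xpair_eqE /low /= mulf_eq0 (negbTE k0) /=.
have [k1|k1|/eqP] := ltgtP k 0; last by rewrite (negbTE k0).
  rewrite !(nmulr_rlt0 _ k1) addbT.
  by case: (ltgtP y 0) => //= _; case: (ltgtP x 0).
by rewrite !(pmulr_rlt0 _ k1) addbF.
Qed.

Lemma low_add u v : u != (0, 0) -> v != (0, 0) -> low u = low v ->
  low (u.1 + v.1, u.2 + v.2) = low u.
Proof.
move=> /low_cone + /low_cone + e; rewrite -e {3}/low.
case: u v {e} => [x y] [x' y'] /=; case: (low _) => h h'.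
  apply/orP; case/orP: h => [y0|/andP[/eqP y0 x0]];
    case/orP: h' => [y0'|/andP[/eqP y0' x0']]; first by left; lra.
  - by left; lra.
  - by left; lra.
  - by right; rewrite y0 y0' addr0 eqxx /=; lra.
apply/negbTE; rewrite negb_or -leNgt negb_and -leNgt.
case/orP: h => [y0|/andP[/eqP y0 x0]]; case/orP: h' => [y0'|/andP[/eqP y0' x0']].
- by rewrite gt_eqF ?andbT /=; lra.
- by rewrite gt_eqF ?andbT /=; lra.
- by rewrite gt_eqF ?andbT /=; lra.
- by rewrite y0 y0' addr0 lexx eqxx /=; lra.
Qed.

(** The half-plane test is additive: if both summands lie in the same half-plane, so does [u]. A
    negative coefficient flips the half-plane, and a zero coefficient imposes no condition. *)
Lemma low_lin (d x y : R) u a b e : 0 < d -> u != (0, 0) -> a != (0, 0) ->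
  b != (0, 0) -> d * u.1 = x * a.1 + y * b.1 -> d * u.2 = x * a.2 + y * b.2 ->
  (x != 0 -> low a (+) (x < 0) = e) -> (y != 0 -> low b (+) (y < 0) = e) ->
  low u = e.
Proof.
move=> d0 u0 a0 b0 e1 e2 xe ye.
have nz k w : k != 0 -> w != (0, 0) -> (k * w.1, k * w.2) != (0, 0) :> R * R.
  by move=> k0; case: w => w1 w2; rewrite !xpair_eqE !mulf_eq0 (negbTE k0).
have dn : d != 0 by rewrite gt_eqF.
have := low_scale dn u0; rewrite e1 e2 ltNge (ltW d0) addbF => <-.
have [x0|x0] := eqVneq x 0; have [y0|y0] := eqVneq y 0.
- have := nz _ _ dn u0; rewrite e1 e2 x0 y0 !mul0r addr0 eqxx //.
- by rewrite x0 !mul0r !add0r low_scale // ye.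
- by rewrite y0 !mul0r !addr0 low_scale // xe.
rewrite (@low_add (x * a.1, x * a.2) (y * b.1, y * b.2)) ?low_scale ?nz //; first exact: xe.
by rewrite xe // ye.
Qed.

(** The last parity term is the correction for a cone that contains the zero direction. With [cross
    a b * u = cross u b * a + cross a u * b], [low_lin] excludes the inconsistent combinations of
    signs and half-planes. *)
Lemma ang_lt_cone a b u : a != (0, 0) -> b != (0, 0) -> u != (0, 0) ->
  0 < cross a b -> ~~ same_dir a u -> ~~ same_dir b u ->
  (0 < cross a u) && (0 < cross u b) = ang_lt a u (+) ang_lt b u (+) ang_lt b a.
Proof.
move=> a0 b0 u0 ab au bu.
have L e := @low_lin (cross a b) (cross u b) (cross a u) u a b e ab u0 a0 b0 _ _.
have {}L e : (cross u b != 0 -> low a (+) (cross u b < 0) = e) ->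
    (cross a u != 0 -> low b (+) (cross a u < 0) = e) -> low u = e.
  by apply: L; rewrite /cross; ring.
move: au bu; rewrite /ang_lt /same_dir (crossC b u) oppr_eq0 oppr_gt0.
rewrite (crossC b a) oppr_gt0 [cross a b < 0]ltNge (ltW ab) /=.
have {L} := L (~~ low u).
case: (ltgtP (cross u b) 0) => _; case: (ltgtP (cross a u) 0) => _ /=;
case: (low a); case: (low b); case: (low u) => //= L;
by discriminate (L ltac:(by []) ltac:(by [])).
Qed.

(** The factor [cross a b] makes the test independent of the orientation of the pair. *)
Definition in_cone a b u :=
  (0 < cross a b * cross a u) && (0 < cross a b * cross u b).

Lemma in_coneC a b u : in_cone b a u = in_cone a b u.
Proof.
by rewrite /in_cone (crossC b a) (crossC b u) (crossC u a) !mulrNN andbC.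
Qed.

(** In [ang_lt_cone] the term [ang_lt b a] does not involve [u], so it cancels between [u] and
    [v]. *)
Lemma ang_lt_diff a b u v : a != (0, 0) -> b != (0, 0) -> u != (0, 0) ->
  v != (0, 0) -> cross a b != 0 -> ~~ same_dir a u -> ~~ same_dir b u ->
  ~~ same_dir a v -> ~~ same_dir b v -> in_cone a b u = in_cone a b v ->
  ang_lt a u (+) ang_lt b u = ang_lt a v (+) ang_lt b v.
Proof.
wlog ab : a b / 0 < cross a b.
  move=> H a0 b0 u0 v0 ab0 au bu av bv uv.
  have [|ab|/eqP] := ltgtP (cross a b) 0; last by rewrite (negbTE ab0).
    rewrite -oppr_gt0 -crossC => ba.
    have ba0 : cross b a != 0 by rewrite gt_eqF.
    have uv' : in_cone b a u = in_cone b a v by rewrite (in_coneC a b u) uv -(in_coneC a b v).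
    have := H b a ba b0 a0 u0 v0 ba0 bu au bv av uv'.
    by rewrite addbC => ->; rewrite addbC.
  exact: (H a b ab a0 b0 u0 v0 ab0 au bu av bv uv).
move=> a0 b0 u0 v0 _ au bu av bv; rewrite /in_cone !(pmulr_rgt0 _ ab).
by rewrite !ang_lt_cone // => /addIb.
Qed.

(* If [u] is inside the cone and [v] outside, follow [uv] until it leaves the
   cone: that point lies on the drawn part of the ray through [a] or [b], or
   else [uv] has crossed the segment [ab] before. *)
Lemma cone_crossing a b u v : cross a b != 0 ->
  (forall s t, 0 <= s <= 1 -> 0 <= t <= 1 ->
     (s * a.1, s * a.2) <> on_seg u v t) ->
  (forall s t, 0 <= s <= 1 -> 0 <= t <= 1 ->
     (s * b.1, s * b.2) <> on_seg u v t) ->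
  (forall s t, 0 <= s <= 1 -> 0 <= t <= 1 ->
     (s * u.1, s * u.2) <> on_seg a b t) ->
  (forall s t, 0 <= s <= 1 -> 0 <= t <= 1 ->
     on_seg u v t <> on_seg a b s) ->
  in_cone a b u -> in_cone a b v.
Proof.
move=> D0 Ha Hb Hu Huv.
(* Coordinates in the basis [a], [b]: the cone is where both are positive, and the line through [a]
   and [b] is [x + y = 1]. *)
pose x w := cross w b / cross a b; pose y w := cross a w / cross a b.
have sg0 (w : R) : (0 < cross a b * w) = (0 < w / cross a b).
  rewrite -[RHS](pmulr_rgt0 _ (_ : 0 < cross a b ^+ 2)); last by rewrite exprn_even_gt0.
  by congr (_ < _); field.
have coneE w : in_cone a b w = (0 < x w) && (0 < y w).
  by rewrite /in_cone !sg0 andbC.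
have decomp w : w = (x w * a.1 + y w * b.1, x w * a.2 + y w * b.2).
  rewrite /x /y /cross in D0 *; case: w => w1 w2 /=; congr (_, _); field; exact: D0.
rewrite !coneE => /andP[xu yu].
have xseg t : x (on_seg u v t) = (1 - t) * x u + t * x v.
  by rewrite /x /on_seg /cross /=; field; exact: D0.
have yseg t : y (on_seg u v t) = (1 - t) * y u + t * y v.
  by rewrite /y /on_seg /cross /=; field; exact: D0.
(* Otherwise the segment from the origin to [u] would meet the segment [ab]. *)
have u1 : x u + y u < 1.
  rewrite ltNge; apply/negP => u1.
  have s0 : 0 < x u + y u by lra.
  apply: (Hu (x u + y u)^-1 (y u / (x u + y u))).
  - by rewrite invr_ge0 (ltW s0) invf_le1.
  - by rewrite divr_ge0 ?(ltW s0) ?(ltW yu) //= ler_pdivrMr //; lra.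
  - have [-> ->] : u.1 = x u * a.1 + y u * b.1 /\ u.2 = x u * a.2 + y u * b.2.
      by split; rewrite {1}[u]decomp.
    by rewrite /on_seg; congr (_, _); field; rewrite gt_eqF.
have ab_seg t : 0 <= t <= 1 -> 0 <= x (on_seg u v t) -> 0 <= y (on_seg u v t) ->
    x (on_seg u v t) + y (on_seg u v t) <> 1.
  move=> t01 x0 y0 xy1; apply: (Huv (y (on_seg u v t)) t) => //; first by apply/andP; split; lra.
  rewrite {1}[on_seg u v t]decomp [in RHS]/on_seg.
  by have -> : 1 - y (on_seg u v t) = x (on_seg u v t) by lra.
(* A point of [uv] in the closed cone beyond the line [x + y = 1] would force an earlier crossing of
   [ab], at fraction [k] of the way. *)
have stop t : 0 <= t <= 1 -> 0 <= x (on_seg u v t) -> 0 <= y (on_seg u v t) ->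
    x (on_seg u v t) + y (on_seg u v t) <= 1.
  move=> t01 x0 y0; rewrite leNgt; apply/negP => gt1.
  set p := on_seg u v t in x0 y0 gt1.
  pose k := (1 - (x u + y u)) / (x p + y p - (x u + y u)).
  have k0 : 0 <= k by rewrite divr_ge0 //; lra.
  have k1 : k <= 1 by rewrite ler_pdivrMr; lra.
  have tk : 0 <= t * k <= 1 by nra.
  have xk : x (on_seg u v (t * k)) = (1 - k) * x u + k * x p.
    by rewrite /p !xseg; ring.
  have yk : y (on_seg u v (t * k)) = (1 - k) * y u + k * y p.
    by rewrite /p !yseg; ring.
  apply: (ab_seg (t * k)) => //; rewrite ?xk ?yk; try nra.
  by rewrite /k; field; rewrite gt_eqF //; lra.
have noa t : 0 <= t <= 1 -> 0 <= x (on_seg u v t) -> y (on_seg u v t) <> 0.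
  move=> t01 x0 y0; have x1 := stop t t01 x0.
  rewrite y0 lexx addr0 in x1.
  apply: (Ha (x (on_seg u v t)) t) => //; first by rewrite x0 x1.
  by rewrite [RHS]decomp y0 !mul0r !addr0.
have nob t : 0 <= t <= 1 -> 0 <= y (on_seg u v t) -> x (on_seg u v t) <> 0.
  move=> t01 y0 x0; have y1 := stop t t01.
  rewrite x0 lexx add0r in y1.
  apply: (Hb (y (on_seg u v t)) t) => //; first by rewrite y0 y1.
  by rewrite [RHS]decomp x0 !mul0r !add0r.
rewrite !ltNge -negb_or; apply/negP => out.
(* The parameters at which [uv] meets the lines [x = 0] and [y = 0]. At the earlier of the two the
   other coordinate is still nonnegative, so a drawn spoke is hit. *)
pose tx := x u / (x u - x v); pose ty := y u / (y u - y v).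
have txP : x v <= 0 -> 0 <= tx <= 1 /\ x (on_seg u v tx) = 0.
  move=> xv; split; last by rewrite xseg /tx; field; rewrite gt_eqF //; lra.
  by apply/andP; split; [rewrite divr_ge0 //|rewrite ler_pdivrMr]; lra.
have tyP : y v <= 0 -> 0 <= ty <= 1 /\ y (on_seg u v ty) = 0.
  move=> yv; split; last by rewrite yseg /ty; field; rewrite gt_eqF //; lra.
  by apply/andP; split; [rewrite divr_ge0 //|rewrite ler_pdivrMr]; lra.
have cross_both : x v <= 0 -> y v <= 0 ->
    0 <= y (on_seg u v tx) \/ 0 <= x (on_seg u v ty).
  move=> xv yv; have [t1 e1] := txP xv; have [t2 e2] := tyP yv.
  rewrite xseg in e1; rewrite yseg in e2; rewrite xseg yseg.
  have [le|lt] := leP tx ty; [left|right]; nra.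
have [xv|xv] := leP (x v) 0; have [yv|yv] := leP (y v) 0.
- have [t1 e1] := txP xv; have [t2 e2] := tyP yv.
  by case: (cross_both xv yv) => [/(nob _ t1)|/(noa _ t2)]; apply.
- have [t1 e1] := txP xv; apply: (nob _ t1 _ e1); rewrite yseg; nra.
- have [t2 e2] := tyP yv; apply: (noa _ t2 _ e2); rewrite xseg; nra.
- by move: out; rewrite !leNgt xv yv.
Qed.

End Angles.

(** * Monotone subsequences of a labelled list *)

Section Sequences.
Variable T : eqType.
Implicit Types (s : seq T) (p : pred T) (lab : T -> nat).

Lemma leq_has_inc k k' w : (k <= k')%N -> has_inc k' w -> has_inc k w.
Proof.
move=> kk' /asboolP[t [tw st ts]]; apply/asboolP; exists t; split=> //.
exact: leq_trans ts.
Qed.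

Lemma has_inc_filter s p lab :
  pairwise (fun x y => p x && p y ==> (lab x < lab y)%N) s ->
  has_inc (count p s) (map lab s).
Proof.
move=> ps; apply/asboolP; exists (map lab (filter p s)); split.
- by rewrite map_subseq // filter_subseq.
- apply: pairwise_sorted; rewrite pairwise_map; elim: s ps => //= x s IH.
  case/andP => /allP xs /IH ps; case: ifP => //= px; rewrite ps andbT.
  apply/allP => y; rewrite mem_filter => /andP[py ys] /=.
  by have := xs y ys; rewrite px py.
- by rewrite size_map size_filter.
Qed.

Lemma has_dec_filter s p lab :
  pairwise (fun x y => p x && p y ==> (lab y < lab x)%N) s ->
  has_inc (count p s) (map lab (rev s)).
Proof.
move=> ps; rewrite -count_rev; apply: has_inc_filter.
elim: s ps => //= x s IH /andP[/allP xs /IH ps].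
rewrite rev_cons pairwise_rcons ps andbT; apply/allP => y.
by rewrite mem_rev => /xs; rewrite andbC.
Qed.

(** The decreasing part is read backwards, so both parts are increasing runs in a prefix, of [s] or
    of [rev s]. *)
Lemma unimodal_has_inc s p lab l : uniq s -> (l <= size s)%N ->
  (forall x y, p x -> p y -> (index x s < index y s)%N ->
     (index y s < l)%N -> (lab x < lab y)%N) ->
  (forall x y, p x -> p y -> (l <= index x s)%N ->
     (index x s < index y s < size s)%N -> (lab y < lab x)%N) ->
  has_inc (count p (take l s)) (map lab (take l s)) /\
  has_inc (count p (drop l s)) (map lab (take (size s - l) (rev s))).
Proof.
move=> us ls Hinc Hdec; split.
  apply: has_inc_filter; case: s us ls Hinc {Hdec} => // x0 s us ls Hinc.
  apply/(pairwiseP x0) => i j; rewrite !inE size_takel // => il jl ij.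
  rewrite !nth_take //; apply/implyP => /andP[pi pj].
  by apply: Hinc; rewrite ?index_uniq //; apply: leq_trans ls.
rewrite take_rev subKn //; apply: has_dec_filter.
case: s us ls Hdec {Hinc} => // x0 s us ls Hdec.
apply/(pairwiseP x0) => i j; rewrite !inE size_drop => il jl ij.
rewrite !nth_drop; apply/implyP => /andP[pi pj].
have li : (l + i < size (x0 :: s))%N by rewrite -ltn_subRL.
have lj : (l + j < size (x0 :: s))%N by rewrite -ltn_subRL.
by apply: Hdec; rewrite ?index_uniq ?leq_addr ?ltn_add2l ?ij.
Qed.

Lemma index_rot r s x : uniq s -> x \in s -> (r <= size s)%N ->
  index x (rot r s) =
  if (index x s < r)%N then (index x s + (size s - r))%N else (index x s - r)%N.
Proof.
move=> us xs rs; have ix : (index x s < size s)%N by rewrite index_mem.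
set k := if _ then _ else _.
have kx : nth x (rot r s) k = x.
  rewrite /rot nth_cat size_drop /k; case: (ltnP (index x s) r) => ir.
    by rewrite ltnNge leq_addl /= addnK nth_take // nth_index.
  rewrite ltn_sub2r ?(leq_ltn_trans ir) //.
  by rewrite nth_drop subnKC // nth_index.
rewrite -{1}kx index_uniq ?rot_uniq // size_rot /k.
case: (ltnP (index x s) r) => ir; last first.
  exact: leq_ltn_trans (leq_subr _ _) ix.
by rewrite -{2}(subnKC rs) ltn_add2r.
Qed.

(** A rotation changes the comparison by one term in [x] and one in [y]; such terms cancel in second
    differences. *)
Lemma index_rot_lt r s x y : uniq s -> x \in s -> y \in s -> (r <= size s)%N ->
  (index x (rot r s) < index y (rot r s))%N =
  (index x s < index y s)%N (+) (index x s < r)%N (+) (index y s < r)%N.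
Proof.
move=> us xs ys rs; rewrite !index_rot //.
have : (index x s < size s)%N by rewrite index_mem.
have : (index y s < size s)%N by rewrite index_mem.
move: (index x s) (index y s) (size s) rs => i j n rn jn i_n.
by case: (ltnP i r); case: (ltnP j r); case: (ltnP i j) => /=; lia.
Qed.

End Sequences.

(* [alt2 chi a b u v] is the second difference, modulo 2, of the
   order relation [chi]; it is [false] when [u] and [v] are on the same side of
   the pair [a], [b] in the cyclic order. *)
Definition alt2 (T : Type) (chi : T -> T -> bool) a b u v :=
  chi a u (+) chi b u (+) (chi a v (+) chi b v).

(** * Index pairs that do not separate each other cyclically *)

Section Alternation.
Variables (m : nat) (chi : nat -> nat -> bool).

Lemma alt2_transl a b c u v :
  alt2 chi a b u v = false -> alt2 chi b c u v = false ->
  alt2 chi a c u v = false.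
Proof.
rewrite /alt2; case: (chi a u) (chi a v) (chi b u) => -[] [];
by case: (chi b v) (chi c u) (chi c v) => -[] [].
Qed.

Lemma alt2_transr a b u v w :
  alt2 chi a b u v = false -> alt2 chi a b v w = false ->
  alt2 chi a b u w = false.
Proof.
rewrite /alt2; case: (chi a u) (chi a v) (chi b u) => -[] [];
by case: (chi b v) (chi a w) (chi b w) => -[] [].
Qed.

Lemma alt2_syml a b u v : alt2 chi a b u v = alt2 chi b a u v.
Proof. by rewrite /alt2 addbC [chi a v (+) _]addbC addbC [chi b u (+) _]addbC. Qed.

Lemma alt2_symr a b u v : alt2 chi a b u v = alt2 chi a b v u.
Proof. by rewrite /alt2 addbC. Qed.

Lemma alt2_id a u v : alt2 chi a a u v = false.
Proof. by rewrite /alt2 !addbb. Qed.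

Lemma alt2_idr a b u : alt2 chi a b u u = false.
Proof. by rewrite /alt2 addbb. Qed.

Lemma alt2_interval a b u v :
  (forall k, (u <= k < v)%N -> alt2 chi a b k k.+1 = false) ->
  (u <= v)%N -> alt2 chi a b u v = false.
Proof.
elim: v => [|v IH] H; first by rewrite leqn0 => /eqP ->; exact: alt2_idr.
rewrite leq_eqVlt => /predU1P[->|uv]; first exact: alt2_idr.
apply: (@alt2_transr _ _ _ v); last by apply: H; rewrite ltnS in uv; rewrite uv /=.
by apply: IH => // k /andP[uk kv]; apply: H; rewrite uk ltnW.
Qed.

Hypothesis path_edges : forall i k, (i.+1 < m)%N -> (k.+1 < m)%N ->
  (i.+1 < k)%N || (k.+1 < i)%N -> alt2 chi i i.+1 k k.+1 = false.

(** Second differences telescope, edge by edge, along both disjoint intervals. *)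
Lemma alt2_path a b u v : (a <= b < m)%N -> (u <= v < m)%N ->
  (b < u)%N || (v < a)%N -> alt2 chi a b u v = false.
Proof.
move=> /andP[ab bm] /andP[uv vm] buva.
elim: b ab bm buva => [|b IH] ab bm buva.
  by move: ab; rewrite leqn0 => /eqP ->; exact: alt2_id.
move: ab; rewrite leq_eqVlt => /predU1P[->|ab]; first exact: alt2_id.
apply: (@alt2_transl _ b); first by apply: IH; lia.
by apply: alt2_interval => // k kuv; apply: path_edges; lia.
Qed.

Hypothesis cycle_edge : forall k, (0 < k)%N -> (k.+1 < m.-1)%N ->
  alt2 chi m.-1 0 k k.+1 = false.

(** Go from [f] to [g] the other way round the cycle, down to 0, over the closing edge to [m.-1],
    then down to [g]; this avoids [u] to [v]. *)
Lemma alt2_cycle f g u v : (f < u)%N -> (u <= v)%N -> (v < g < m)%N ->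
  alt2 chi f g u v = false.
Proof.
move=> fu uv vgm; apply: (@alt2_transl _ 0).
  by rewrite alt2_syml; apply: alt2_path; lia.
apply: (@alt2_transl _ m.-1); last first.
  by rewrite alt2_syml; apply: alt2_path; lia.
rewrite alt2_syml; apply: alt2_interval => // k kuv.
by apply: cycle_edge; lia.
Qed.

End Alternation.

(** * Drawings with a hub *)

Section Hub.
Variables (R : realType) (H : sgraph).
Variable pi : join_graph H (empty_graph 1) -> R * R.
Hypothesis pi_plane : plane_drawing pi.

Definition vec (c p : R * R) : R * R := (p.1 - c.1, p.2 - c.2).

Definition hub_pos : R * R := pi (inr ord0).

Definition spoke (i : H) : R * R := vec hub_pos (pi (inl i)).

Let G := join_graph H (empty_graph 1).

Lemma disjoint_edges (u v x y : G) s t : adj u v -> adj x y ->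
  u != x -> u != y -> v != x -> v != y ->
  0 <= s <= 1 -> 0 <= t <= 1 ->
  on_seg (pi u) (pi v) s <> on_seg (pi x) (pi y) t.
Proof.
case: pi_plane => inj noX _ uv xy /eqP ux /eqP uy /eqP vx /eqP vy s01 t01 e.
have ne : [set u; v]%classic <> [set x; y]%classic.
  move=> E; have : [set x; y]%classic u by rewrite -E; left.
  by case.
have := noX u v x y uv xy ne (on_seg (pi u) (pi v) s).
case; first by split; [exists s|rewrite e; exists t].
by case=> -> [] /inj.
Qed.

Lemma vertex_off_edge (u v w : G) t : adj u v -> w != u -> w != v ->
  0 <= t <= 1 -> on_seg (pi u) (pi v) t <> pi w.
Proof.
case: pi_plane => _ _ off uv wu wv t01 e; apply: (off u v w uv wu wv).
by rewrite -e; exists t.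
Qed.

Lemma spoke_neq0 i : spoke i != (0, 0).
Proof.
apply/eqP => -[/subr0_eq e1 /subr0_eq e2]; case: pi_plane => inj _ _.
have /inj // : pi (inl i) = pi (inr ord0).
by move: e1 e2; rewrite /hub_pos; case: (pi _) (pi _) => [? ?] [? ?] /= -> ->.
Qed.

Lemma parallel_scale (u v : R * R) : v != (0, 0) -> cross u v = 0 ->
  exists k, u = (k * v.1, k * v.2).
Proof.
case: u v => [u1 u2] [v1 v2]; rewrite xpair_eqE /cross /= negb_and => v0 uv.
case/orP: v0 => [v0|v0].
  exists (u1 / v1); congr (_, _); first by field.
  apply: (mulfI v0); transitivity (u1 * v2); last by field.
  by rewrite -[RHS]subr0 -uv; ring.
exists (u2 / v2); congr (_, _); last by field.
apply: (mulfI v0); transitivity (u2 * v1); last by field.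
by rewrite -[LHS]subr0 -uv; ring.
Qed.

(** Otherwise the nearer of the two rim vertices would lie on the edge from the hub to the other. *)
Lemma spokes_distinct i j : i != j -> ~~ same_dir (spoke i) (spoke j).
Proof.
move=> ij; apply/negP => /andP[/eqP low_ij /eqP /(parallel_scale (spoke_neq0 j))[k ki]].
have k0 : k != 0.
  by apply/eqP => k0; have := spoke_neq0 i; rewrite ki k0 !mul0r eqxx.
have kp : 0 < k.
  have := low_scale k0 (spoke_neq0 j); rewrite -ki low_ij.
  have [_|//|/eqP] := ltgtP k 0; last by rewrite (negbTE k0).
  by case: (low _).
have ki1 : (pi (inl i)).1 - hub_pos.1 = k * ((pi (inl j)).1 - hub_pos.1).
  by have := congr1 fst ki.
have ki2 : (pi (inl i)).2 - hub_pos.2 = k * ((pi (inl j)).2 - hub_pos.2).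
  by have := congr1 snd ki.
have [k1|k1] := leP k 1.
  have k01 : 0 <= k <= 1 by rewrite (ltW kp) k1.
  apply: (@vertex_off_edge (inr ord0) (inl j) (inl i) k) => //.
  rewrite /on_seg -/hub_pos [RHS]surjective_pairing; congr (_, _); lra.
have kV : 0 <= k^-1 <= 1 by rewrite invr_ge0 (ltW kp) invf_le1 // ltW.
apply: (@vertex_off_edge (inr ord0) (inl i) (inl j) k^-1) => //.
  by apply: contra_neq ij => -[].
rewrite /on_seg -/hub_pos [RHS]surjective_pairing; congr (_, _).
  by apply: (mulfI k0);
    transitivity (k * hub_pos.1 + ((pi (inl i)).1 - hub_pos.1));
    [field|rewrite ki1; ring].
by apply: (mulfI k0);
    transitivity (k * hub_pos.2 + ((pi (inl i)).2 - hub_pos.2));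
    [field|rewrite ki2; ring].
Qed.

(** Parallel spokes would be opposite, which puts the hub on the rim edge. *)
Lemma spoke_cross i j : adj i j -> cross (spoke i) (spoke j) != 0.
Proof.
move=> ij; have nij : i != j by apply: contraTneq ij => ->; rewrite adj_irr.
apply/eqP => c0; have [k ki] := parallel_scale (spoke_neq0 j) c0.
have k0 : k != 0.
  by apply/eqP => k0; have := spoke_neq0 i; rewrite ki k0 !mul0r eqxx.
have kn : k < 0.
  have := spokes_distinct nij; rewrite /same_dir c0 eqxx andbT.
  have := low_scale k0 (spoke_neq0 j); rewrite -ki => ->.
  by case: (k < 0) => //; rewrite addbF eqxx.
have ki1 : (pi (inl i)).1 - hub_pos.1 = k * ((pi (inl j)).1 - hub_pos.1).
  by have := congr1 fst ki.
have ki2 : (pi (inl i)).2 - hub_pos.2 = k * ((pi (inl j)).2 - hub_pos.2).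
  by have := congr1 snd ki.
have k1 : 1 - k != 0 by rewrite gt_eqF //; lra.
pose t := - k / (1 - k).
have t01 : 0 <= t <= 1.
  by apply/andP; split; [rewrite divr_ge0 //|rewrite ler_pdivrMr]; lra.
apply: (@vertex_off_edge (inl i) (inl j) (inr ord0) t) => //.
rewrite /on_seg -/hub_pos [RHS]surjective_pairing /t; congr (_, _).
  apply: (mulfI k1); transitivity ((pi (inl i)).1 - k * (pi (inl j)).1); first by field.
  by move: ki1; rewrite mulrBr; lra.
apply: (mulfI k1); transitivity ((pi (inl i)).2 - k * (pi (inl j)).2); first by field.
by move: ki2; rewrite mulrBr; lra.
Qed.

Lemma spoke_cone i j k l : adj i j -> adj k l ->
  i != k -> i != l -> j != k -> j != l ->
  in_cone (spoke i) (spoke j) (spoke k) -> in_cone (spoke i) (spoke j) (spoke l).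
Proof.
move=> ij kl ik il jk jl.
have hub_edge a b c s t : adj b c -> a != b -> a != c ->
    0 <= s <= 1 -> 0 <= t <= 1 ->
    (s * (spoke a).1, s * (spoke a).2) <> on_seg (spoke b) (spoke c) t.
  move=> bc ab ac s01 t01 [e1 e2].
  apply: (@disjoint_edges (inr ord0) (inl a) (inl b) (inl c) s t) => //.
  rewrite /on_seg; congr (_, _); [move: e1|move: e2]; rewrite /spoke /hub_pos /=;
  by rewrite !mulrBr; lra.
apply: cone_crossing; first exact: spoke_cross.
- by move=> s t; exact: hub_edge.
- by move=> s t; exact: hub_edge.
- by move=> s t; apply: hub_edge; rewrite // eq_sym.
move=> s t s01 t01 [e1 e2].
apply: (@disjoint_edges (inl k) (inl l) (inl i) (inl j) t s) => //;
  rewrite 1?eq_sym //.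
rewrite /on_seg; congr (_, _); [move: e1|move: e2]; rewrite /spoke /hub_pos /=;
by rewrite !mulrBr; lra.
Qed.

Lemma spoke_alt2 i j k l : adj i j -> adj k l ->
  i != k -> i != l -> j != k -> j != l ->
  alt2 (fun a b => ang_lt (spoke a) (spoke b)) i j k l = false.
Proof.
move=> ij kl ik il jk jl; rewrite /alt2.
rewrite (@ang_lt_diff _ (spoke i) (spoke j) (spoke k) (spoke l)) ?addbb //;
  rewrite ?spoke_neq0 ?spoke_cross ?spokes_distinct //.
by apply/idP/idP; apply: spoke_cone => //; rewrite adj_sym.
Qed.

End Hub.

(** * Points sorted by angle around a centre *)

Section AngularList.
Variables (R : realType) (n : nat) (x : 'I_n -> R * R).
Implicit Types (c : R * R) (i j : 'I_n).

(** A point at the centre has no direction; it goes last, so that the list is always a permutation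
    of all indices. *)
Definition ang_list c : seq 'I_n :=
  sort (fun i j => ang_le (vec c (x i)) (vec c (x j)))
       [seq i <- enum 'I_n | x i != c] ++
  [seq i <- enum 'I_n | x i == c].

Lemma perm_ang_list c : perm_eq (ang_list c) (enum 'I_n).
Proof.
rewrite perm_catC; apply: (@perm_trans _ ([seq i <- enum 'I_n | x i == c] ++
  [seq i <- enum 'I_n | x i != c])).
  by rewrite perm_cat2l perm_sort.
exact/permPl/(perm_filterC (fun i => x i == c)).
Qed.

Lemma ang_list_uniq c : uniq (ang_list c).
Proof. by rewrite (perm_uniq (perm_ang_list c)) enum_uniq. Qed.

Lemma mem_ang_list c i : i \in ang_list c.
Proof. by rewrite (perm_mem (perm_ang_list c)) mem_enum. Qed.

Lemma size_ang_list c : size (ang_list c) = n.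
Proof. by rewrite (perm_size (perm_ang_list c)) size_enum_ord. Qed.

Lemma vec_neq0 c p : (vec c p != (0, 0)) = (p != c).
Proof. by case: c p => [? ?] [? ?]; rewrite !xpair_eqE !subr_eq0. Qed.

Lemma index_ang_list c i j : x i != c -> x j != c ->
  ~~ same_dir (vec c (x i)) (vec c (x j)) ->
  (index i (ang_list c) < index j (ang_list c))%N =
  ang_lt (vec c (x i)) (vec c (x j)).
Proof.
move=> ic jc sd.
set leT := fun i j => ang_le (vec c (x i)) (vec c (x j)).
have mem k : x k != c -> k \in sort leT [seq i <- enum 'I_n | x i != c].
  by move=> kc; rewrite mem_sort mem_filter kc mem_enum.
have tr : {in [pred k | x k != c] & &, transitive leT}.
  move=> a b d; rewrite !inE => ac bc dc.
  by apply: ang_le_trans; rewrite inE vec_neq0.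
have imp k l : x k != c -> x l != c ->
    (index k (ang_list c) < index l (ang_list c))%N -> leT k l.
  move=> kc lc; rewrite /ang_list !index_cat !mem //.
  apply: (@sorted_ltn_index_in _ leT); rewrite ?mem //.
    by move=> a b d; rewrite !mem_sort !mem_filter => /andP[ac _] /andP[bc _] /andP[dc _];
      exact: tr.
  apply: (@sort_sorted_in _ [pred k | x k != c]); last exact: filter_all.
  by move=> a b _ _; exact: ang_le_total.
apply/idP/idP => [lt|]; first by rewrite ang_lt_le //; exact: imp.
rewrite ang_ltNge //; apply: contraNT; rewrite -leqNgt leq_eqVlt.
case/predU1P => [e|lt].
  have ij : j = i.
    by rewrite -(nth_index i (mem_ang_list c j)) e nth_index // mem_ang_list.
  by move: sd; rewrite ij /same_dir eqxx /cross mulrC subrr eqxx.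
have sd' : ~~ same_dir (vec c (x j)) (vec c (x i)).
  by move: sd; rewrite /same_dir eq_sym crossC oppr_eq0.
by rewrite ang_lt_le //; exact: imp.
Qed.

(** As functions of the centre: the cross product of two point vectors, affine because its quadratic
    terms cancel, and the two coordinates of each point vector. *)
Definition ang_forms : seq (R * R * R) :=
  [seq ((x ij.1).2 - (x ij.2).2, (x ij.2).1 - (x ij.1).1,
        (x ij.1).1 * (x ij.2).2 - (x ij.1).2 * (x ij.2).1)
      | ij <- enum {: 'I_n * 'I_n}] ++
  [seq (-1, 0, (x i).1) | i <- enum 'I_n] ++
  [seq (0, -1, (x i).2) | i <- enum 'I_n].

Lemma size_ang_forms : size ang_forms = (n * n + (n + n))%N.
Proof.
rewrite !size_cat (size_map _ (enum {: 'I_n * 'I_n})) !(size_map _ (enum 'I_n)).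
by rewrite size_enum_ord -cardE card_prod card_ord.
Qed.

Lemma eq_ang_list c c' : same_signs ang_forms c c' -> ang_list c = ang_list c'.
Proof.
move=> /allP H.
have H1 i j : ((x i).2 - (x j).2, (x j).1 - (x i).1,
    (x i).1 * (x j).2 - (x i).2 * (x j).1) \in ang_forms.
  rewrite !mem_cat; apply/or3P; apply: Or31; apply/mapP.
  by exists (i, j); rewrite ?mem_enum.
have H2 i : (-1, 0, (x i).1) \in ang_forms.
  rewrite !mem_cat; apply/or3P; apply: Or32; apply/mapP.
  by exists i; rewrite ?mem_enum.
have H3 i : (0, -1, (x i).2) \in ang_forms.
  rewrite !mem_cat; apply/or3P; apply: Or33; apply/mapP.
  by exists i; rewrite ?mem_enum.
have e1 i j : Num.sg (cross (vec c (x i)) (vec c (x j))) =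
              Num.sg (cross (vec c' (x i)) (vec c' (x j))).
  have /eqP := H _ (H1 i j); rewrite /aff /= => h.
  have E d : cross (vec d (x i)) (vec d (x j)) =
    ((x i).2 - (x j).2) * d.1 + ((x j).1 - (x i).1) * d.2 +
    ((x i).1 * (x j).2 - (x i).2 * (x j).1) by rewrite /cross /=; ring.
  by rewrite !E.
have e2 i : Num.sg (vec c (x i)).1 = Num.sg (vec c' (x i)).1.
  have /eqP := H _ (H2 i); rewrite /aff /= => h.
  have E (d : R * R) : (x i).1 - d.1 = -1 * d.1 + 0 * d.2 + (x i).1 by ring.
  by rewrite !E.
have e3 i : Num.sg (vec c (x i)).2 = Num.sg (vec c' (x i)).2.
  have /eqP := H _ (H3 i); rewrite /aff /= => h.
  have E (d : R * R) : (x i).2 - d.2 = 0 * d.1 + -1 * d.2 + (x i).2 by ring.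
  by rewrite !E.
have sg_lt0 (a b : R) : Num.sg a = Num.sg b -> (a < 0) = (b < 0).
  by move=> e; rewrite -[LHS]sgr_lt0 e sgr_lt0.
have sg_eq0 (a b : R) : Num.sg a = Num.sg b -> (a == 0) = (b == 0).
  by move=> e; rewrite -[LHS]sgr_eq0 e sgr_eq0.
have lowE i : low (vec c (x i)) = low (vec c' (x i)).
  by rewrite /low (sg_lt0 _ _ (e2 i)) (sg_lt0 _ _ (e3 i)) (sg_eq0 _ _ (e3 i)).
have nE i : (x i == c) = (x i == c').
  apply: negb_inj; rewrite -(vec_neq0 c) -(vec_neq0 c') !xpair_eqE.
  by rewrite (sg_eq0 _ _ (e2 i)) (sg_eq0 _ _ (e3 i)).
have leE i j : ang_le (vec c (x i)) (vec c (x j)) =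
               ang_le (vec c' (x i)) (vec c' (x j)).
  by rewrite /ang_le !lowE -[0 <= cross (vec c _) _]sgr_ge0 e1 sgr_ge0.
rewrite /ang_list (eq_filter nE); congr (_ ++ _).
rewrite (@eq_filter _ (fun i => x i != c) (fun i => x i != c')); last first.
  by move=> i; rewrite /= nE.
by congr (sort _ _); apply: funext => i; apply: funext => j.
Qed.

End AngularList.

(** * Fixed rim vertices *)

Section Rim.
Variables (R : realType) (m n : nat) (e : rel 'I_m.+1).
Hypotheses (e_sym : symmetric e) (e_irr : irreflexive e).
Hypothesis e_path : forall i j : 'I_m.+1, j = i.+1 :> nat -> e i j.

Let H := SGraph e_sym e_irr.

Variable pi : join_graph H (empty_graph 1) -> R * R.
Hypothesis pi_plane : plane_drawing pi.

Variables (x : 'I_n -> R * R) (sigma : 'I_m.+1 -> 'I_n) (lab : 'I_n -> nat).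
Hypothesis lab_sigma : forall i j : 'I_m.+1, (i < j)%N -> (lab (sigma i) < lab (sigma j))%N.

Definition fixed_rim : {set 'I_m.+1} := [set i | pi (inl i) == x (sigma i)].

Local Notation F := fixed_rim.
Local Notation L := (ang_list x (hub_pos pi)).

Let sigma_inj : injective sigma.
Proof.
move=> i j eij; apply: val_inj => /=.
by case: (ltngtP i j) => // /lab_sigma; rewrite eij ltnn.
Qed.

Let chi (a b : nat) := ang_lt (spoke pi (inord a)) (spoke pi (inord b)).

Let chi_edges (i j k l : nat) : (i < m.+1)%N -> (j < m.+1)%N -> (k < m.+1)%N ->
  (l < m.+1)%N -> e (inord i) (inord j) -> e (inord k) (inord l) ->
  i != k -> i != l -> j != k -> j != l -> alt2 chi i j k l = false.
Proof.
move=> im jm km lm ij kl ik il jk jl; apply: spoke_alt2 => //;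
by rewrite -val_eqE /= !inordK.
Qed.

Let chi_path i k : (i.+1 < m.+1)%N -> (k.+1 < m.+1)%N ->
  (i.+1 < k)%N || (k.+1 < i)%N -> alt2 chi i i.+1 k k.+1 = false.
Proof.
move=> im km ik; apply: chi_edges; rewrite ?e_path ?inordK //; lia.
Qed.

Section Rotation.
Variable r : nat.
Hypothesis rn : (r <= n)%N.

Local Notation K := (rot r L).
Let P (i : 'I_m.+1) := index (sigma i) K.

Let P_inj : injective P.
Proof.
move=> i j ij; apply: sigma_inj.
have mem y : y \in K by rewrite mem_rot mem_ang_list.
by rewrite -(nth_index (sigma i) (mem (sigma i))) -[index _ _]/(P i) ij nth_index.
Qed.

(** A fixed vertex sits at its given point, so up to the rotation its place in the list is governed
    by the spokes of the drawing. *)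
Let P_lt i j : i \in F -> j \in F -> i != j ->
  (P i < P j)%N =
  chi i j (+) (index (sigma i) L < r)%N (+) (index (sigma j) L < r)%N.
Proof.
rewrite !inE => /eqP iF /eqP jF ij.
rewrite /P index_rot_lt ?ang_list_uniq ?mem_ang_list ?size_ang_list //.
congr (_ (+) _ (+) _); rewrite index_ang_list -?iF -?jF.
- by rewrite /chi !inord_val.
- by rewrite -vec_neq0; exact: spoke_neq0.
- by rewrite -vec_neq0; exact: spoke_neq0.
- exact: spokes_distinct.
Qed.

Let P_alt2 (a b u v : 'I_m.+1) : a \in F -> b \in F -> u \in F -> v \in F ->
  a != u -> a != v -> b != u -> b != v -> alt2 chi a b u v = false ->
  (P a < P u)%N (+) (P b < P u)%N (+) ((P a < P v)%N (+) (P b < P v)%N) = false.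
Proof.
move=> aF bF uF vF au av bu bv; rewrite !P_lt // /alt2 => <-.
case: (_ < r)%N (_ < r)%N (_ < r)%N (_ < r)%N => -[] [] [];
by case: (chi a u) (chi b u) (chi a v) (chi b v) => -[] [] [].
Qed.

Variables f0 g : 'I_m.+1.
Hypotheses (f0F : f0 \in F) (gF : g \in F).
Hypotheses (f0_min : forall i, i \in F -> (f0 <= i)%N)
           (g_max : forall i, i \in F -> (i <= g)%N).
Hypothesis P_f0 : P f0 = 0%N.

Let P_gt0 i : i != f0 -> (0 < P i)%N.
Proof. by move=> if0; rewrite lt0n -P_f0; apply: contra_neq if0 => /P_inj. Qed.

(** Both [i] and [k] exceed [j], so [f0] and [j] do not separate them; but in a valley [i] lies
    between positions 0 and [P j], and [k] lies beyond. *)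
Lemma no_valley i j k : i \in F -> j \in F -> k \in F -> (j < i)%N -> (j < k)%N ->
  (P i < P j)%N -> (P j < P k)%N -> False.
Proof.
move=> iF jF kF ji jk ij jk'.
have f0j : f0 != j by apply: contraTneq ij => <-; rewrite P_f0.
have f0j_lt : (f0 < j)%N by rewrite ltn_neqAle f0j f0_min.
have ne (a b : 'I_m.+1) : (a < b)%N -> a != b by move=> ab; rewrite -val_eqE /= neq_ltn ab.
have f0i := ne _ _ (ltn_trans f0j_lt ji); have f0k := ne _ _ (ltn_trans f0j_lt jk).
have alt : alt2 chi f0 j i k = false.
  have [ik|ki] := leqP i k; [|rewrite alt2_symr];
  by apply: (alt2_path (m := m.+1)) => //; have := ltn_ord i; have := ltn_ord k; lia.
have := P_alt2 f0F jF iF kF f0i f0k (ne _ _ ji) (ne _ _ jk) alt.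
rewrite P_f0 !P_gt0 1?eq_sym // jk' ltnNge (ltnW ij) //.
Qed.

Let p y := [exists i, (i \in F) && (sigma i == y)].

Let count_p : count p K = #|F|.
Proof.
have perm_K : perm_eq K (enum 'I_n).
  by apply: perm_trans (perm_ang_list x (hub_pos pi)); rewrite perm_rot.
rewrite (permP perm_K) enumT -(card_imset _ sigma_inj) cardE size_filter.
apply: eq_count => y; apply/existsP/imsetP.
  by case=> i /andP[iF /eqP <-]; exists i.
by case=> i iF ->; exists i; rewrite iF eqxx.
Qed.

(** Cut just after [g], the largest fixed index: a descent before it, or an ascent after it, would
    form a valley together with [g]. *)
Lemma fan_rotation : exists l k1 k2, [/\ (l <= n)%N,
  has_inc k1 (map lab (take l K)),
  has_inc k2 (map lab (take (n - l) (rev K))) & (#|F| <= k1 + k2)%N].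
Proof.
have PK i : (P i < n)%N.
  by rewrite -[X in (_ < X)%N](size_ang_list x (hub_pos pi)) -(size_rot r)
    index_mem mem_rot mem_ang_list.
have sK : size K = n by rewrite size_rot size_ang_list.
exists (P g).+1, (count p (take (P g).+1 K)), (count p (drop (P g).+1 K)).
have [] := @unimodal_has_inc _ K p lab (P g).+1.
- by rewrite rot_uniq ang_list_uniq.
- by rewrite sK.
- move=> _ _ /existsP[i /andP[iF /eqP <-]] /existsP[j /andP[jF /eqP <-]].
  rewrite -/(P i) -/(P j) => ij jg; apply: lab_sigma.
  rewrite ltnNge leq_eqVlt; apply/negP => /predU1P[/val_inj ji|ji].
    by rewrite ji ltnn in ij.
  have jg' : (j < g)%N := leq_trans ji (g_max iF).
  apply: (no_valley iF jF gF ji jg' ij).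
  rewrite ltn_neqAle -ltnS jg andbT; apply/eqP => /P_inj e'.
  by rewrite e' ltnn in jg'.
- move=> _ _ /existsP[i /andP[iF /eqP <-]] /existsP[j /andP[jF /eqP <-]].
  rewrite -/(P i) -/(P j) => gi /andP[ij _]; apply: lab_sigma.
  rewrite ltnNge leq_eqVlt; apply/negP => /predU1P[/val_inj ji|ji].
    by rewrite ji ltnn in ij.
  have ig : (i < g)%N.
    rewrite ltn_neqAle g_max // andbT; apply/eqP => /val_inj e'.
    by rewrite e' ltnn in gi.
  exact: (no_valley gF iF jF ig ji gi ij).
rewrite sK => h1 h2; split=> //.
by rewrite -count_cat cat_take_drop count_p.
Qed.

Hypothesis e_cycle : (2 <= m)%N -> e (inord m) (inord 0).

Let chi_cycle k : (0 < k)%N -> (k.+1 < m)%N -> alt2 chi m 0 k k.+1 = false.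
Proof.
move=> k0 km; apply: chi_edges; rewrite ?e_cycle ?e_path ?inordK //; lia.
Qed.

(** The closing edge makes [f0] and [g] not separate the fixed indices strictly between them, so
    these all lie on one side of [g] and the cut falls at an end. *)
Lemma wheel_rotation : exists l k1 k2, [/\ (l == 0)%N || (l == n),
  has_inc k1 (map lab (take l K)),
  has_inc k2 (map lab (take (n - l) (rev K))) & (#|F| <= k1 + k2 + 1)%N].
Proof.
have sK : size K = n by rewrite size_rot size_ang_list.
have same_side i j : i \in F -> j \in F -> (f0 < i < g)%N -> (f0 < j < g)%N ->
    (P g < P i)%N = (P g < P j)%N.
  have ne (a b : 'I_m.+1) : (a < b)%N -> a != b by move=> ab; rewrite -val_eqE /= neq_ltn ab.
  wlog ij : i j / (i <= j)%N.
    by move=> W iF jF hi hj; have [/W->|/ltnW/W->] := leqP i j.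
  move=> iF jF /andP[fi ig] /andP[fj jg].
  have alt : alt2 chi f0 g i j = false.
    by apply: (alt2_cycle (m := m.+1)) => //; rewrite jg /=.
  have := P_alt2 f0F gF iF jF (ne _ _ fi) (ne _ _ fj) _ _ alt.
  rewrite ![g == _]eq_sym => /(_ (ne _ _ ig) (ne _ _ jg)).
  rewrite P_f0 !P_gt0 1?eq_sym ?ne //.
  by case: (P g < P i)%N (P g < P j)%N => -[].
(* [f0] comes first and has the least label among the fixed vertices, which would spoil a decreasing
   run; it is left out and paid for by the [+ 1]. *)
pose q y := p y && (y != sigma f0).
have qP y : q y -> exists i, [/\ y = sigma i, i \in F & (f0 < i)%N].
  case/andP => /existsP[i /andP[iF /eqP <-]] if0; exists i; split=> //.
  rewrite ltn_neqAle f0_min // andbT; apply: contraNneq if0 => f0i.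
  by apply/eqP; congr sigma; apply: val_inj.
have count_q : (#|F| <= count q K + 1)%N.
  rewrite -count_p.
  apply: (@leq_trans (count (predU q (pred1 (sigma f0))) K)).
    by apply: sub_count => y /= py; rewrite /q py; case: (y == _).
  apply: (@leq_trans (count q K + count (pred1 (sigma f0)) K)).
    by rewrite -count_predUI leq_addr.
  by rewrite leq_add2l count_uniq_mem ?leq_b1 // rot_uniq ang_list_uniq.
have uK : uniq K by rewrite rot_uniq ang_list_uniq.
have [inc|/negP] := boolP [forall i in F, (f0 < i < g)%N ==> (P i < P g)%N].
  exists n, (count q (take n K)), (count q (drop n K)).
  have before i : i \in F -> (f0 < i < g)%N -> (P i < P g)%N.
    by move=> iF ig; move/forall_inP: inc => /(_ _ iF); rewrite ig.
  have [] := @unimodal_has_inc _ K q lab n uK; first by rewrite sK.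
  - move=> _ _ /qP[i [-> iF fi]] /qP[j [-> jF fj]].
    rewrite -/(P i) -/(P j) => ij _; apply: lab_sigma.
    rewrite ltnNge leq_eqVlt; apply/negP => /predU1P[/val_inj ji|ji].
      by rewrite ji ltnn in ij.
    have jg : (j < g)%N := leq_trans ji (g_max iF).
    apply: (no_valley iF jF gF ji jg ij).
    by apply: before; rewrite ?fj.
  - move=> y z _ _ ny /andP[yz zn].
    by move: (leq_trans (leq_ltn_trans ny yz) (ltnW zn)); rewrite sK ltnn.
  rewrite sK => h1 h2; split=> //; first by rewrite eqxx orbT.
  by rewrite -count_cat cat_take_drop.
move=> ninc; exists 0%N, (count q (take 0 K)), (count q (drop 0 K)).
have after i : i \in F -> (f0 < i < g)%N -> (P g < P i)%N.
  move=> iF ig; apply: contrapT => /negP gi; apply: ninc.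
  apply/forall_inP => j jF; apply/implyP => jg.
  rewrite ltn_neqAle leqNgt -(same_side i j) // gi andbT.
  by apply/eqP => /P_inj ejg; move: jg; rewrite ejg ltnn andbF.
have [] := @unimodal_has_inc _ K q lab 0 uK; first by [].
- by [].
- move=> _ _ /qP[i [-> iF fi]] /qP[j [-> jF fj]].
  rewrite -/(P i) -/(P j) => _ /andP[ij _]; apply: lab_sigma.
  rewrite ltnNge leq_eqVlt; apply/negP => /predU1P[/val_inj ji|ji].
    by rewrite ji ltnn in ij.
  have ig : (i < g)%N := leq_trans ji (g_max jF).
  have gi : (P g < P i)%N by apply: after; rewrite ?fi.
  exact: (no_valley gF iF jF ig ji gi ij).
rewrite sK => h1 h2; split=> //.
by rewrite -count_cat cat_take_drop.
Qed.

End Rotation.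

Let first_fixed : F != finset.set0 -> exists f0 g, [/\ f0 \in F, g \in F,
  forall i, i \in F -> (f0 <= i)%N & forall i, i \in F -> (i <= g)%N].
Proof.
case/finset.set0Pn => i0 i0F.
case: (arg_minnP (fun i : 'I_m.+1 => nat_of_ord i) i0F) => f0 f0F f0_min.
case: (arg_maxnP (fun i : 'I_m.+1 => nat_of_ord i) i0F) => g gF g_max.
by exists f0, g.
Qed.

Let index_rot_self i : index (sigma i) (rot (index (sigma i) L) L) = 0%N.
Proof.
rewrite index_rot ?ang_list_uniq ?mem_ang_list ?index_size //.
by rewrite ltnn subnn.
Qed.

Let has_inc0 w : has_inc 0 w.
Proof. by apply/asboolP; exists [::]; split=> //; exact: sub0seq. Qed.

Lemma fan_fixed : exists r l k1 k2, [/\ (r <= n)%N, (l <= n)%N,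
  has_inc k1 (map lab (take l (rot r L))),
  has_inc k2 (map lab (take (n - l) (rev (rot r L)))) &
  (#|F| <= k1 + k2 + 1)%N].
Proof.
have [F0|F0] := eqVneq F finset.set0.
  by exists 0%N, 0%N, 0%N, 0%N; rewrite F0 cards0.
have [f0 [g [f0F gF f0_min g_max]]] := first_fixed F0.
have rn : (index (sigma f0) L <= n)%N.
  by rewrite -[X in (_ <= X)%N](size_ang_list x (hub_pos pi)) index_size.
have [l [k1 [k2 [ln h1 h2 le]]]] :=
  fan_rotation rn f0F gF f0_min g_max (index_rot_self f0).
by exists (index (sigma f0) L), l, k1, k2; split=> //; rewrite addn1 ltnW.
Qed.

Lemma wheel_fixed : ((2 <= m)%N -> e (inord m) (inord 0)) ->
  exists r l k1 k2, [/\ (r <= n)%N, (l == 0)%N || (l == n),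
  has_inc k1 (map lab (take l (rot r L))),
  has_inc k2 (map lab (take (n - l) (rev (rot r L)))) &
  (#|F| <= k1 + k2 + 1)%N].
Proof.
move=> e_cycle; have [F0|F0] := eqVneq F finset.set0.
  by exists 0%N, 0%N, 0%N, 0%N; rewrite F0 cards0.
have [f0 [g [f0F gF f0_min g_max]]] := first_fixed F0.
have rn : (index (sigma f0) L <= n)%N.
  by rewrite -[X in (_ <= X)%N](size_ang_list x (hub_pos pi)) index_size.
have [l [k1 [k2 [ln h1 h2 le]]]] :=
  wheel_rotation rn f0F gF f0_min g_max (index_rot_self f0) e_cycle.
by exists (index (sigma f0) L), l, k1, k2.
Qed.

End Rim.

(** * Labellings without long monotone subsequences *)

Lemma leq_ffact_expn M k : (M ^_ k <= M ^ k)%N.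
Proof.
elim: k => [|k IH] //; rewrite ffactnSr expnSr.
by apply: leq_mul => //; exact: leq_subr.
Qed.

(** Birthday bound, multiplied through by [M]: each new letter has at most [n] predecessors to
    collide with. *)
Lemma expn_leq_ffact M n k : (k <= n)%N ->
  (M ^ k.+1 <= M * M ^_ k + k * n * M ^ k)%N.
Proof.
elim: k => [|k IH] kn; first by rewrite expn1 ffactn0 muln1 mul0n addn0.
have := IH (ltnW kn); have := leq_ffact_expn M k.
rewrite ffactnSr [(M ^ k.+2)%N]expnS [(M ^ k.+1)%N]expnS.
move: (M ^ k)%N (M ^_ k)%N => a b ba le.
have h1 : (M * (M * a) <= M * (M * b + k * n * a))%N by rewrite leq_mul2l le orbT.
have h2 : (M * b * k <= M * a * n)%N.
  by apply: leq_mul; [rewrite leq_mul2l ba orbT|exact: ltnW].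
apply: leq_trans h1 _.
have h3 : (M * (b * M) <= M * (b * (M - k) + b * k))%N.
  rewrite leq_mul2l -mulnDr leq_mul2l; have : (M <= M - k + k)%N by lia.
  by move=> ->; rewrite !orbT.
nia.
Qed.

Lemma card_has_leq (T : finType) (E : Type) (P : T -> E -> bool) (evs : seq E) :
  (#|[set f | has (P f) evs]| <= \sum_(ev <- evs) #|[set f | P f ev]|)%N.
Proof.
elim: evs => [|ev evs IH]; first by rewrite big_nil cards0.
rewrite big_cons; apply: leq_trans (leq_add (leqnn _) IH).
apply: leq_trans (leq_card_setU _ _); apply: subset_leq_card.
by apply/fintype.subsetP => f; rewrite !inE.
Qed.

Lemma card_has_inc_perm (n M l k : nat) (K : seq 'I_n) : perm_eq K (enum 'I_n) ->
  (#|[set f : {ffun 'I_n -> 'I_M} |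
       has_inc k (map (fun i => nat_of_ord (f i)) (take l K))]| <=
   #|[set w : n.-tuple 'I_M | has_inc k (map (@nat_of_ord M) (take l w))]|)%N.
Proof.
move=> permK; have sK : size K = n by rewrite (perm_size permK) size_enum_ord.
have word_size f : size (map (f : {ffun 'I_n -> 'I_M}) K) == n by rewrite size_map sK.
pose word f := Tuple (word_size f).
have word_inj : injective word.
  move=> f g /(congr1 val) /= /eq_in_map fg; apply/ffunP => i.
  by apply: fg; rewrite (perm_mem permK) mem_enum.
rewrite -(card_imset _ word_inj); apply: subset_leq_card.
apply/fintype.subsetP => w /imsetP[f]; rewrite !inE => hf ->.
by rewrite /= -map_take -map_comp.
Qed.

Section Labelling.
Variables (R : realType) (delta : R).
Hypothesis delta01 : 0 < delta <= 1.

(** Half of the forbidden length: it serves once for the initial particles and once for the entries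
    through the upper end. *)
Definition inc_bound (n l : nat) : nat :=
  (Num.trunc (Num.sqrt l%:R + 2 * delta * Num.sqrt n%:R)).+1.

Lemma inc_bound_ge n l :
  Num.sqrt l%:R + 2 * delta * Num.sqrt n%:R <= (inc_bound n l)%:R.
Proof. by apply: ltW; exact: truncnS_gt. Qed.

Lemma inc_bound_le n l :
  (inc_bound n l)%:R <= Num.sqrt l%:R + 2 * delta * Num.sqrt n%:R + 1.
Proof.
rewrite /inc_bound -[X in X <= _]natr1 lerD2r truncn_le addr_ge0 ?sqrtr_ge0 //.
by rewrite !mulr_ge0 ?sqrtr_ge0 //; case/andP: delta01 => /ltW.
Qed.

Definition good_labelling n M (x : 'I_n -> R * R) (f : 'I_n -> 'I_M) :=
  injective f /\ forall c r l, (r <= n)%N -> (l <= n)%N ->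
    let K := rot r (ang_list x c) in
    let bad w := has_inc (inc_bound n l + inc_bound n l)
                   (map (fun i => nat_of_ord (f i)) w) in
    ~~ bad (take l K) /\ ~~ bad (take l (rev K)).

(** The constant is [4 * 392]: the tail factor times the coefficient in the bound [392 * n ^ 6] on
    the number of bad events. *)
Lemma exp_beats_poly :
  exists n0 : nat, forall n, (n0 <= n)%N ->
    1568 * n%:R ^+ 6 * expR (- (delta ^+ 2 / 16 * Num.sqrt n%:R)) < 1 / 2.
Proof.
have /andP[d0 _] := delta01.
set a := delta ^+ 2 / 16; have a0 : 0 < a by rewrite divr_gt0 // exprn_gt0.
have [C C0 CP] : exists2 C : R, 0 <= C &
    forall n, n%:R ^+ 7 <= C * expR (a * Num.sqrt n%:R).
  (* The term of order 14 of the exponential series gives [n%:R ^+ 7], one power more than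
     required. *)
  exists (14`!%:R / a ^+ 14) => [|n].
    by rewrite divr_ge0 // exprn_ge0 // ltW.
  have y0 : 0 <= a * Num.sqrt n%:R by rewrite mulr_ge0 ?sqrtr_ge0 // ltW.
  have := expR_ge1Dxn 13 y0; rewrite exprMn.
  have -> : Num.sqrt n%:R ^+ 14 = n%:R ^+ 7 :> R.
    by rewrite (exprM _ 2 7) sqr_sqrtr.
  move=> h; have {}h : a ^+ 14 * n%:R ^+ 7 / 14`!%:R <= expR (a * Num.sqrt n%:R).
    by apply: le_trans h; rewrite lerDr.
  rewrite ler_pdivrMr ?ltr0n ?fact_gt0 // in h.
  by rewrite mulrAC ler_pdivlMr ?exprn_gt0 // mulrC [leRHS]mulrC.
exists (Num.bound (3136 * C)).+1 => n n0.
have nC : 3136 * C < n%:R.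
  apply: lt_le_trans (archi_boundP _) _; first by rewrite mulr_ge0.
  by rewrite ler_nat ltnW.
have n_gt0 : 0 < n%:R :> R by apply: le_lt_trans nC; rewrite mulr_ge0.
rewrite expRN.
have E0 : 0 < expR (a * Num.sqrt n%:R) by exact: expR_gt0.
rewrite ltr_pdivrMr //.
rewrite -(ltr_pM2l n_gt0).
have -> : n%:R * (1568 * n%:R ^+ 6) = 1568 * n%:R ^+ 7 :> R by ring.
apply: (@le_lt_trans _ _ (1568 * (C * expR (a * Num.sqrt n%:R)))).
  by rewrite ler_pM2l.
have -> : n%:R * (1 / 2 * expR (a * Num.sqrt n%:R)) =
  1568 * (n%:R / 3136 * expR (a * Num.sqrt n%:R)) by field.
rewrite ltr_pM2l // ltr_pM2r // ltr_pdivlMr //; lra.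
Qed.


Lemma sqrt_unbounded (C : R) :
  exists n0 : nat, forall n, (n0 <= n)%N -> C <= Num.sqrt n%:R.
Proof.
exists (Num.bound (C ^+ 2)) => n n0.
have [C0|C0] := leP C 0; first exact: le_trans C0 (sqrtr_ge0 _).
rewrite -(ger0_norm (ltW C0)) -sqrtr_sqr; apply: ler_wsqrtr.
apply: ltW; apply: lt_le_trans (archi_boundP _) _; first exact: sqr_ge0.
by rewrite ler_nat.
Qed.

Lemma card_bad_labels n M l (K : seq 'I_n) :
  5 <= delta ^+ 2 * Num.sqrt n%:R -> (n ^ 2 <= M)%N -> (0 < M)%N -> (l <= n)%N ->
  perm_eq K (enum 'I_n) ->
  #|[set f : {ffun 'I_n -> 'I_M} | has_inc (inc_bound n l + inc_bound n l)
       (map (fun i => nat_of_ord (f i)) (take l K))]|%:R <=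
  4 * expR (- (delta ^+ 2 / 16 * Num.sqrt n%:R)) * M%:R ^+ n.
Proof.
move=> dn nM M0 ln permK.
have := has_inc_word_tail delta01 dn nM ln (inc_bound_ge n l).
rewrite word_mean_tuple exprVn mulrC ler_pdivrMr ?exprn_gt0 ?ltr0n //.
apply: le_trans; rewrite -natr_sum ler_nat.
apply: leq_trans (card_has_inc_perm _ _ _ permK) _.
rewrite -sum1_card big_mkcond /=; apply: leq_sum => w _.
by rewrite inE; case: (has_inc _ _).
Qed.

(** Union bound over sign classes of centres, rotations, cuts and reading directions: fewer than
    half of all labellings are bad, while at least half are injective. *)
Lemma exists_good_labelling : exists n0 : nat, forall n, (n0 <= n)%N ->
  forall x : 'I_n -> R * R, exists M (f : 'I_n -> 'I_M), good_labelling x f.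
Proof.
have /andP[d0 d1] := delta01.
have [n1 n1P] := exp_beats_poly; have [n2 n2P] := sqrt_unbounded (5 / delta ^+ 2).
exists (maxn 2 (maxn n1 n2)) => n; rewrite !geq_max => /and3P[n_ge2 /n1P small /n2P].
rewrite ler_pdivrMr ?exprn_gt0 // mulrC => dn x.
(* Large enough for [2 * n ^ 2 <= M], so that the birthday bound leaves half of the labellings
   injective. *)
pose M := (n ^ 3)%N; exists M.
have M0 : (0 < M)%N by rewrite expn_gt0; lia.
have nM : (n ^ 2 <= M)%N by rewrite leq_exp2l.
have [cs [cs_size cs_rep]] := plane_sign_reps (ang_forms x).
have [ns nsP ns_size] : exists2 s : seq nat,
    forall i, (i \in s) = (i <= n)%N & size s = n.+1.
  by exists (iota 0 n.+1) => [i|]; rewrite ?mem_iota ?size_iota.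
pose params := [seq (r, l) | r <- ns, l <- ns].
pose evs1 := [seq (rot rl.1 (ang_list x c), rl.2) | c <- cs, rl <- params].
pose evs := evs1 ++ [seq (rev ev.1, ev.2) | ev <- evs1].
have evs1P ev : ev \in evs1 -> perm_eq ev.1 (enum 'I_n) /\ (ev.2 <= n)%N.
  case/allpairsP => -[c rl] /= [_ /allpairsP[[r l] /= [_ ll ->]] ->] /=.
  split; last by rewrite -nsP.
  by apply: perm_trans (perm_ang_list x c); rewrite perm_rot.
have evsP ev : ev \in evs -> perm_eq ev.1 (enum 'I_n) /\ (ev.2 <= n)%N.
  rewrite mem_cat => /orP[/evs1P//|/mapP[ev' /evs1P[p l] ->]] /=.
  by split=> //; apply: perm_trans p; rewrite perm_rev.
(* At most [(7 * n ^ 2) ^ 2] classes of centres, [4 * n ^ 2] pairs of rotation and cut, and 2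
   directions. *)
have evs_size : (size evs <= 392 * n ^ 6)%N.
  rewrite size_cat size_map !size_allpairs !ns_size.
  rewrite size_ang_forms in cs_size.
  have h1 : (1 + 3 * (n * n + (n + n)) <= 7 * (n * n))%N by nia.
  have h2 : (size cs <= (7 * (n * n)) ^ 2)%N.
    by apply: leq_trans cs_size _; rewrite leq_exp2r.
  have h3 : (n.+1 * n.+1 <= 4 * (n * n))%N by nia.
  have h4 := leq_mul h2 h3.
  have -> : (392 * n ^ 6 = (7 * (n * n)) ^ 2 * (4 * (n * n)) * 2)%N.
    by rewrite !expnS !expn0; nia.
  by rewrite muln2 -addnn leq_add.
pose bad (f : {ffun 'I_n -> 'I_M}) (ev : seq 'I_n * nat) :=
  has_inc (inc_bound n ev.2 + inc_bound n ev.2)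
    (map (fun i => nat_of_ord (f i)) (take ev.2 ev.1)).
have [|nex] := pselect (exists f : {ffun 'I_n -> 'I_M}, injective f /\ ~~ has (bad f) evs).
  case=> f [f_inj /hasPn good]; exists f; split=> // c r l rn ln K bd.
  have [c' c'cs /eq_ang_list ec] := cs_rep c.
  have ev1 : (K, l) \in evs1.
    apply/allpairsP; exists (c', (r, l)); split=> //=; last by rewrite /K ec.
    by apply/allpairsP; exists (r, l); rewrite !nsP.
  split; first by apply: (good (K, l)); rewrite mem_cat ev1.
  apply: (good (rev K, l)); rewrite mem_cat; apply/orP; right.
  by apply/mapP; exists (K, l).
exfalso.
have le1 : (M ^_ n <= \sum_(ev <- evs) #|[set f | bad f ev]|)%N.
  apply: leq_trans (card_has_leq _ _).
  have := card_inj_ffuns 'I_n 'I_M; rewrite !card_ord => <-.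
  apply: subset_leq_card; apply/fintype.subsetP => f; rewrite !inE => /injectiveP fi.
  by apply: contrapT => /negP nb; apply: nex; exists f.
have le2 : (M ^ n <= 2 * M ^_ n)%N.
  have := @expn_leq_ffact M n n (leqnn n); rewrite expnS => h.
  have h' : (2 * (n * n) <= M)%N by rewrite /M !expnS expn0; nia.
  have h2 : (2 * (n * n) * M ^ n <= M * M ^ n)%N by rewrite leq_mul2r h' orbT.
  rewrite -(leq_pmul2l M0); move: (M ^ n)%N (M ^_ n)%N h h2 => a b; nia.
set tau := expR _ in small.
have tau0 : 0 <= tau by exact: expR_ge0.
have le3 : (M ^_ n)%:R <= 1568 * n%:R ^+ 6 * tau * M%:R ^+ n.
  apply: (@le_trans _ _ (\sum_(ev <- evs) 4 * tau * M%:R ^+ n)).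
    apply: (@le_trans _ _ (\sum_(ev <- evs) #|[set f | bad f ev]|)%:R).
      by rewrite ler_nat.
    rewrite natr_sum !big_seq; apply: ler_sum => ev /evsP[pev lev].
    exact: card_bad_labels.
  rewrite big_const_seq count_predT iter_addr_0 -[leLHS]mulr_natr.
  have -> : 1568 * n%:R ^+ 6 * tau * M%:R ^+ n =
            4 * tau * M%:R ^+ n * (392 * n ^ 6)%:R.
    by rewrite natrM natrX; ring.
  by rewrite ler_wpM2l ?ler_nat // !mulr_ge0 ?exprn_ge0.
have Mn0 : 0 < M%:R ^+ n :> R by rewrite exprn_gt0 ?ltr0n.
have : M%:R ^+ n <= 2 * (M ^_ n)%:R :> R by rewrite -natrX -natrM ler_nat.
have : 1568 * n%:R ^+ 6 * tau * M%:R ^+ n < 1 / 2 * M%:R ^+ n by rewrite ltr_pM2r.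
lra.
Qed.

End Labelling.

(** * Bounding FIX *)

Lemma sort_label n M (f : 'I_n -> 'I_M) : injective f ->
  exists2 s : 'I_n -> 'I_n, injective s &
    forall i j : 'I_n, (i < j)%N -> (f (s i) < f (s j))%N.
Proof.
case: n f => [|n] f f_inj; first by exists id => [|[]].
pose leF (i j : 'I_n.+1) := (f i <= f j)%N.
pose t := sort leF (enum 'I_n.+1).
have t_size : size t = n.+1 by rewrite size_sort size_enum_ord.
have t_uniq : uniq t by rewrite sort_uniq enum_uniq.
exists (fun i => nth ord0 t i) => [i j /eqP|i j ij].
  by rewrite nth_uniq ?t_size // => /eqP /val_inj.
have tr : transitive leF by move=> a b c; exact: leq_trans.
have st : sorted leF t by apply: sort_sorted => a b; exact: leq_total.
rewrite ltn_neqAle; apply/andP; split.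
  apply/eqP => /val_inj /f_inj /eqP; rewrite nth_uniq ?t_size // => /eqP e.
  by rewrite e ltnn in ij.
by apply: (sorted_ltn_nth tr ord0 st); rewrite // inE t_size.
Qed.

Section HubBound.
Variables (R : realType) (delta : R) (m : nat) (e : rel 'I_m.+1).
Hypotheses (e_sym : symmetric e) (e_irr : irreflexive e).

Let H := SGraph e_sym e_irr.
Let G := join_graph H (empty_graph 1).
Let n := m.+2.

Let card_G : #|G| = n.
Proof. by rewrite card_sum !card_ord addn1. Qed.

Definition vertex_num (v : G) : 'I_n :=
  match v with inl i => widen_ord (leqnSn m.+1) i | inr _ => ord_max end.

Let vertex_num_inj : injective vertex_num.
Proof.
move=> [i|i] [j|j] /(congr1 val) /=.
- by move=> ij; congr inl; apply: val_inj.
- by move=> ij; have := ltn_ord i; rewrite ij ltnn.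
- by move=> ij; have := ltn_ord j; rewrite -ij ltnn.
- by rewrite !ord1.
Qed.

(* [Q] restricts the cutting positions: it is how the wheel, where the fixed
   vertices are monotone rather than unimodal, gets its better constant. *)
Variable Q : pred nat.
Hypothesis rimQ : forall (pi : G -> R * R), plane_drawing pi ->
  forall (x : 'I_n -> R * R) (sigma : 'I_m.+1 -> 'I_n) (lab : 'I_n -> nat),
  (forall i j : 'I_m.+1, (i < j)%N -> (lab (sigma i) < lab (sigma j))%N) ->
  let L := ang_list x (hub_pos pi) in
  exists r l k1 k2, [/\ (r <= n)%N, (l <= n)%N && Q l,
    has_inc k1 (map lab (take l (rot r L))),
    has_inc k2 (map lab (take (n - l) (rev (rot r L)))) &
    (#|fixed_rim pi x sigma| <= k1 + k2 + 1)%N].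

Hypothesis good : forall x : 'I_n -> R * R,
  exists M (f : 'I_n -> 'I_M), good_labelling delta x f.

(** Vertices, the hub last, receive the points of [X] in order of increasing label, so labels
    increase along the rim. A good labelling then limits both runs given by [rimQ], for every
    drawing. *)
Lemma FIX_hub (beta : R) : 0 <= beta ->
  (forall l, (l <= n)%N -> Q l ->
     (2 * (inc_bound delta n l + inc_bound delta n (n - l)))%:R <= beta) ->
  (FIX R G)%:R <= beta.
Proof.
move=> beta0 betaP; have [X cX <-] := FIX_attained R G.
have [pi0 [pi0_inj pi0X] _] := fix_set_attained cX.
pose x (i : 'I_n) := pi0 (enum_val (cast_ord (esym card_G) i)).
have [M [f [f_inj goodf]]] := good x.
have [s s_inj s_mono] := sort_label f_inj.
pose pi v := x (s (vertex_num v)).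
have pi_inj : injective pi.
  by move=> u v /pi0_inj /enum_val_inj /cast_ord_inj /s_inj /vertex_num_inj.
have pi_range : range pi = X.
  rewrite -pi0X; apply/seteqP; split=> [_ [v _ <-]|_ [v _ <-]].
    by eexists.
  have [h _ hK] : bijective (fun v : G => s (vertex_num v)).
    apply: inj_card_bij; last by rewrite card_G card_ord.
    by move=> u w /s_inj /vertex_num_inj.
  exists (h (cast_ord card_G (enum_rank v))) => //.
  by rewrite /pi hK /x cast_ordK enum_rankK.
rewrite -pi_range; apply: (@le_trans _ _ (fix_drawing pi)%:R).
  by rewrite ler_nat fix_set_lb.
rewrite -truncn_ge_nat //; apply/bigmax_leqP => k /asboolP[pi' pd <-].
rewrite truncn_ge_nat //.
pose sigma (i : 'I_m.+1) := s (vertex_num (inl i)).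
have lab_mono (i j : 'I_m.+1) : (i < j)%N -> (f (sigma i) < f (sigma j))%N.
  by move=> ij; apply: s_mono.
have [r [l [k1 [k2 [rn /andP[ln Ql] h1 h2 hF]]]]] :=
  rimQ pd x (lab := fun i => f i) lab_mono.
apply: le_trans (betaP l ln Ql); rewrite ler_nat.
have nb : (nb_fixed pi pi' <= #|fixed_rim pi' x sigma| + 1)%N.
  rewrite addnC -(cards1 (inr ord0 : G)).
  rewrite -(card_imset (mem (fixed_rim pi' x sigma)) (@inl_inj 'I_m.+1 'I_1)).
  apply: leq_trans (leq_card_setU _ _); apply: subset_leq_card.
  apply/fintype.subsetP => -[i|i]; rewrite !inE => piv.
    by apply/orP; right; apply/imsetP; exists i; rewrite // !inE.
  by rewrite (ord1 i) eqxx.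
have [g1 _] := goodf (hub_pos pi') r l rn ln.
have [_ g2] := goodf (hub_pos pi') r (n - l)%N rn (leq_subr _ _).
have k1_lt : (k1 < inc_bound delta n l + inc_bound delta n l)%N.
  by rewrite ltnNge; apply: contra g1 => le; exact: leq_has_inc le h1.
have k2_lt : (k2 < inc_bound delta n (n - l) + inc_bound delta n (n - l))%N.
  by rewrite ltnNge; apply: contra g2 => le; exact: leq_has_inc le h2.
(* The strict bounds on [k1] and [k2] absorb the hub and the [+ 1] of [rimQ]. *)
by apply: leq_trans nb _; lia.
Qed.

End HubBound.

Lemma sqrt_sum_le (R : realType) (a b : R) : 0 <= a -> 0 <= b ->
  Num.sqrt a + Num.sqrt b <= Num.sqrt 2 * Num.sqrt (a + b).
Proof.
move=> a0 b0; rewrite -sqrtrM //.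
have ab : 0 <= Num.sqrt a + Num.sqrt b by rewrite addr_ge0 ?sqrtr_ge0.
rewrite -[leLHS](ger0_norm ab) -sqrtr_sqr; apply: ler_wsqrtr.
have := sqr_ge0 (Num.sqrt a - Num.sqrt b).
by rewrite sqrrB sqrrD !sqr_sqrtr //; lra.
Qed.

Theorem theorem3p5 (R : realType) (eps : R) (eps_gt0 : 0 < eps) :
  exists n0 : nat, forall n : nat, (n0 <= n)%N ->
    (FIX R (wheel n))%:R <= (2 + eps) * Num.sqrt n%:R :> R /\
    (FIX R (fan n))%:R <= (2 * Num.sqrt 2 + eps) * Num.sqrt n%:R :> R.
Proof.
pose delta := Num.min 1 (eps / 16).
have delta01 : 0 < delta <= 1.
  by rewrite lt_min ge_min lexx ltr01 divr_gt0.
have /andP[delta0 _] := delta01.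
have delta_eps : delta <= eps / 16 by rewrite ge_min lexx orbT.
have [n1 n1P] := exists_good_labelling delta01.
have [n2 n2P] := sqrt_unbounded (8 / eps).
exists (maxn 2 (maxn n1 n2)) => n; rewrite !geq_max => /and3P[n_ge2 n1n n2n].
case: n n_ge2 n1n n2n => [|[|m]] // _ /n1P good /n2P.
set n := m.+2; set S := Num.sqrt n%:R; rewrite ler_pdivrMr // => epsS.
have S0 : 0 <= S by exact: sqrtr_ge0.
have dS : 8 * (delta * S) <= eps * S / 2.
  have := ler_wpM2r S0 delta_eps; lra.
(* The error terms add up to [8 * (delta * S) + 4]; each summand is at most [eps * S / 2]. *)
have bound l : (2 * (inc_bound delta n l + inc_bound delta n (n - l)))%:R <=
    2 * (Num.sqrt l%:R + Num.sqrt (n - l)%:R) + eps * S.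
  have := inc_bound_le delta01 n l; have := inc_bound_le delta01 n (n - l).
  rewrite natrM natrD -/S -mulrA; lra.
split.
- apply: (@FIX_hub R delta m (@cycle_adj m.+1) (@cycle_adj_sym _) (@cycle_adj_irr _)
    [pred l | (l == 0)%N || (l == n)]) => //.
  + move=> pi pd x sigma lab lab_mono L.
    have [||r [l [k1 [k2 [rn ql h1 h2 hF]]]]] :=
      @wheel_fixed R m n _ _ _ _ pi pd x sigma lab lab_mono.
    * move=> i j ij; rewrite /= /cycle_adj ij modn_small -?ij // eqxx andbT.
      by rewrite -val_eqE /= ij neq_ltn ltnSn.
    * move=> m2; rewrite /= /cycle_adj -val_eqE /= !inordK // modnn eqxx /= andbT.
      by rewrite -lt0n; lia.
    exists r, l, k1, k2; split=> //; rewrite inE ql andbT.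
    by case/orP: ql => /eqP ->.
  + by rewrite mulr_ge0 ?addr_ge0 // ltW.
  (* One of [l] and [n - l] is 0, so a single root remains. *)
  + move=> l ln /orP ql; apply: le_trans (bound l) _; rewrite [leRHS]mulrDl lerD2r.
    by case: ql => /eqP ->; rewrite ?subnn ?subn0 sqrtr0 ?add0r ?addr0.
- apply: (@FIX_hub R delta m (@path_adj m.+1) (@path_adj_sym _) (@path_adj_irr _)
    predT) => //.
  + move=> pi pd x sigma lab lab_mono L.
    have [|r [l [k1 [k2 [rn ql h1 h2 hF]]]]] :=
      @fan_fixed R m n _ _ _ _ pi pd x sigma lab lab_mono.
      by move=> i j ij; rewrite /= /path_adj ij eqxx.
    by exists r, l, k1, k2; split=> //; rewrite ql.
  + by rewrite mulr_ge0 ?addr_ge0 ?mulr_ge0 ?sqrtr_ge0 // ltW.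
  + move=> l ln _; apply: le_trans (bound l) _;
    rewrite [leRHS]mulrDl lerD2r -mulrA ler_pM2l //.
    have := @sqrt_sum_le R l%:R (n - l)%:R (ler0n _ _) (ler0n _ _).
    by rewrite -natrD subnKC.
Qed.
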